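(* Let $g:\mathbb R\to\mathbb R$ be real-analytic with $g(0)=0$, $g'(0)=1$, and let $G(x)=\int_0^xg(s)\,ds$. Suppose there exist $a<0<b$ and $c>0$ such that $G(a)=G(b)=c$, and $G(x)<c$ and $x\,g(x)>0$ for all $a<x<b$, $x\ne0$. Let $A$ be the analytic involution of $(a,b)$ defined by $G(A(x))=G(x)$ and $A(x)\,x<0$ for $x\neq0$ (and $A(0)=0$). Then $0$ is an isochronous center of $\ddot x+g(x)=0$ if and only if $$\frac{d}{dx}\left[\frac{G(x)}{g(x)^2}\right]=\frac{4A''(x)}{(1-A'(x))^3}$$ for $x$ in a neighborhood of $0$. Moreover, the last expression is $A$-invariant, i.e. it takes the same value at $x$ and at $A(x)$.
   Context: The equation $\ddot x+g(x)=0$ is identified with the planar system $\dot x=y$, $\dot y=-g(x)$. The center at the origin is called isochronous if all periodic orbits near $(0,0)$ have the same minimal period (which is then $2\pi$). The quotient $G/g^2$ extends analytically to $x=0$ with value $1/2$. *)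

(* Defs.v *)
From Stdlib Require Import Reals.
From Coquelicot Require Import Coquelicot.

Open Scope R_scope.

Definition analytic_at (f : R -> R) (x0 : R) : Prop :=
  exists c : nat -> R, locally x0 (fun x => is_pseries c (x - x0) (f x)).

Definition potential (g : R -> R) (x : R) : R := RInt g 0 x.

Definition is_solution (g x y : R -> R) : Prop :=
  forall t : R, is_derive x t (y t) /\ is_derive y t (- g (x t)).

Definition is_period (x y : R -> R) (T : R) : Prop :=
  0 < T /\ forall t : R, x (t + T) = x t /\ y (t + T) = y t.

(* Constant solutions have no minimal period, hence "having a minimal period"
   means "running along a nontrivial periodic orbit". *)
Definition is_minimal_period (x y : R -> R) (T : R) : Prop :=
  is_period x y T /\ forall T' : R, is_period x y T' -> T <= T'.

(* The origin is an equilibrium with a punctured neighbourhood filled with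
   nontrivial periodic orbits. *)
Definition is_center (g : R -> R) : Prop :=
  g 0 = 0 /\
  locally ((0, 0) : R * R) (fun p => p <> (0, 0) ->
    exists (x y : R -> R) (T : R),
      is_solution g x y /\ (x 0, y 0) = p /\ is_minimal_period x y T).

Definition is_isochronous_center (g : R -> R) : Prop :=
  is_center g /\
  exists T : R, locally ((0, 0) : R * R) (fun p =>
    forall (x y : R -> R) (T' : R),
      is_solution g x y -> (x 0, y 0) = p -> is_minimal_period x y T' ->
      T' = T).

(* The quotient G / g^2, extended to 0 by its limit when g 0 = 0, g' 0 = 1. *)
Definition ext_quotient (g : R -> R) (x : R) : R :=
  if Req_EM_T x 0 then 1 / 2 else potential g x / g x ^ 2.

(* Only the values of A on (a, b) matter. *)
Record is_potential_involution (g : R -> R) (a b : R) (A : R -> R) : Prop := {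
  inv_range : forall x, a < x < b -> a < A x < b;
  inv_invol : forall x, a < x < b -> A (A x) = x;
  inv_analytic : forall x, a < x < b -> analytic_at A x;
  inv_potential : forall x, a < x < b -> potential g (A x) = potential g x;
  inv_sign : forall x, a < x < b -> x <> 0 -> A x * x < 0;
  inv_zero : A 0 = 0
}.

Definition involution_expr (A : R -> R) (x : R) : R :=
  4 * Derive_n A 2 x / (1 - Derive A x) ^ 3.

(* Main.v *)
(** On the level [y^2/2 + G = r^2/2], put [u = U x] with [U^2 = 2 G] and [U x] of the
    sign of [x]; let [X] be the inverse of [U].  The period of this orbit is the
    integral of [X' (r sin phi)] over [0, 2 PI], hence depends only on the even part
    of [X'], and it tends to [2 PI] as [r -> 0].  Since [X (- u) = A (X u)], the even
    part of [X'] minus 1 has at [u = U x > 0] the sign of the function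
    [2 G (1 - A')^2 - 4 g^2] at [x].  This function is analytic, so near 0 it is either
    identically zero (then all periods are [2 PI]) or of constant strict sign for
    [x > 0] (then all small orbits have period larger, respectively smaller, than
    [2 PI], and the period is not constant).  It vanishes near 0 if and only if
    [G / g^2 = 2 / (1 - A')^2] there.  Both sides are [1 / 2] at 0, so this may be
    checked on derivatives, and the derivative of the right-hand side is
    [4 A'' / (1 - A')^3]. *)

Require Import Defs.
From Stdlib Require Import Reals Lra Lia Classical Wf_nat.
From Coquelicot Require Import Coquelicot.

Open Scope R_scope.

(** * Functions analytic at a point *)


Lemma locally_R_iff (P : R -> Prop) (x : R) :
  locally x P <-> exists e : R, 0 < e /\ forall y, Rabs (y - x) < e -> P y.
Proof.
  split.
  - intros [e He]. exists e. split; [apply cond_pos | exact He].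
  - intros (e & He & H). exists (mkposreal e He). exact H.
Qed.

Lemma locally_cv_radius (s : nat -> R) (x0 : R) :
  Rbar_lt 0 (CV_radius s) ->
  locally x0 (fun x => Rbar_lt (Rabs (x - x0)) (CV_radius s)).
Proof.
  intros H. apply locally_R_iff.
  destruct (CV_radius s) as [r | |].
  - exists r. split; [exact H | intros y Hy; exact Hy].
  - exists 1. split; [lra | intros y Hy; exact I].
  - destruct H.
Qed.

Lemma CV_radius_pos (s : nat -> R) (x : R) :
  0 < x -> ex_pseries s x -> Rbar_lt 0 (CV_radius s).
Proof.
  intros Hx Hs. destruct (Rbar_lt_dec (CV_radius s) (Rabs x)) as [Hlt | Hge].
  - exfalso. apply (CV_disk_outside s x Hlt). apply ex_series_lim_0. now apply ex_pseries_R.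
  - apply Rbar_not_lt_le in Hge. eapply Rbar_lt_le_trans; [ | exact Hge].
    simpl. rewrite Rabs_pos_eq; lra.
Qed.

(** Dividing by powers is harmless at a nonzero point: the shifted series converges at [e / 2],
    inside the disk of [s], and this forces a positive radius. *)
Lemma CV_radius_decr_n_pos (s : nat -> R) (n : nat) :
  Rbar_lt 0 (CV_radius s) -> Rbar_lt 0 (CV_radius (PS_decr_n s n)).
Proof.
  intros H. pose proof (locally_cv_radius s 0 H) as K.
  apply locally_R_iff in K. destruct K as (e & He & K).
  apply CV_radius_pos with (e / 2); [lra | ].
  apply ex_pseries_decr_n.
  - right. exists (/ (e / 2)). change (/ (e / 2) * (e / 2) = 1). field. lra.
  - apply CV_radius_inside. specialize (K (e / 2)). rewrite Rminus_0_r in K.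
    apply K. rewrite Rabs_pos_eq; lra.
Qed.

(** Trades pointwise convergence for a positive radius, the form in which power series can be
    differentiated, integrated and shifted. *)
Lemma analytic_at_PSeries (f : R -> R) (x0 : R) :
  analytic_at f x0 <->
  exists s, Rbar_lt 0 (CV_radius s) /\ locally x0 (fun x => f x = PSeries s (x - x0)).
Proof.
  split.
  - intros [s Hs]. exists s. split.
    + apply locally_R_iff in Hs. destruct Hs as (e & He & Hs).
      apply CV_radius_pos with (e / 2); [lra | ].
      assert (Hx : Rabs (x0 + e / 2 - x0) < e)
        by (replace (x0 + e / 2 - x0) with (e / 2) by ring; rewrite Rabs_pos_eq; lra).
      specialize (Hs _ Hx).
      replace (x0 + e / 2 - x0) with (e / 2) in Hs by ring.
      eexists. exact Hs.
    + revert Hs. apply filter_imp. intros x Hx. symmetry. now apply is_pseries_unique.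
  - intros (s & Hr & Hs). exists s.
    generalize (filter_and _ _ (locally_cv_radius s x0 Hr) Hs).
    apply filter_imp. intros x [H1 H2]. rewrite H2.
    apply PSeries_correct. now apply CV_radius_inside.
Qed.

Lemma analytic_at_ext (f h : R -> R) (x0 : R) :
  locally x0 (fun x => f x = h x) -> analytic_at f x0 -> analytic_at h x0.
Proof.
  intros H [s Hs]. exists s. generalize (filter_and _ _ H Hs).
  apply filter_imp. intros x [H1 H2]. now rewrite <- H1.
Qed.

(** Products of series are controlled strictly inside both disks, so the radius bound is recorded
    beside the sum at each nearby point. *)
Lemma analytic_at_locally (f : R -> R) (x0 : R) :
  analytic_at f x0 -> exists s, Rbar_lt 0 (CV_radius s) /\
  locally x0 (fun x => Rbar_lt (Rabs (x - x0)) (CV_radius s) /\ is_pseries s (x - x0) (f x)).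
Proof.
  intros H. apply analytic_at_PSeries in H. destruct H as (s & Hr & Hs).
  exists s. split; [exact Hr | ].
  generalize (filter_and _ _ (locally_cv_radius s x0 Hr) Hs).
  apply filter_imp. intros x [H1 H2]. split; [exact H1 | ]. rewrite H2.
  apply PSeries_correct. now apply CV_radius_inside.
Qed.

Lemma analytic_at_plus (f h : R -> R) (x0 : R) :
  analytic_at f x0 -> analytic_at h x0 -> analytic_at (fun x => f x + h x) x0.
Proof.
  intros [s Hs] [s' Hs']. exists (PS_plus s s').
  generalize (filter_and _ _ Hs Hs'). apply filter_imp.
  intros x [H1 H2]. exact (is_pseries_plus _ _ _ _ _ H1 H2).
Qed.

Lemma analytic_at_scal (k : R) (f : R -> R) (x0 : R) :
  analytic_at f x0 -> analytic_at (fun x => k * f x) x0.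
Proof.
  intros [s Hs]. exists (PS_scal k s).
  revert Hs. apply filter_imp.
  intros x H1. apply (is_pseries_scal k s (x - x0) (f x)); [apply Rmult_comm | exact H1].
Qed.

Lemma analytic_at_mult (f h : R -> R) (x0 : R) :
  analytic_at f x0 -> analytic_at h x0 -> analytic_at (fun x => f x * h x) x0.
Proof.
  intros Hf Hh. apply analytic_at_locally in Hf. apply analytic_at_locally in Hh.
  destruct Hf as (s & _ & Hs). destruct Hh as (s' & _ & Hs'). exists (PS_mult s s').
  generalize (filter_and _ _ Hs Hs'). apply filter_imp.
  intros x [[H1 H2] [H3 H4]]. now apply is_pseries_mult.
Qed.

Lemma is_derive_PSeries_shift (s : nat -> R) (x0 x : R) :
  Rbar_lt (Rabs (x - x0)) (CV_radius s) ->
  is_derive (fun x => PSeries s (x - x0)) x (PSeries (PS_derive s) (x - x0)).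
Proof.
  intros H. replace (PSeries (PS_derive s) (x - x0)) with (1 * PSeries (PS_derive s) (x - x0)) by ring.
  apply (is_derive_comp (PSeries s) (fun x => x - x0)).
  - now apply is_derive_PSeries.
  - auto_derive; [exact I | ring].
Qed.

Lemma analytic_at_derive (f : R -> R) (x0 : R) :
  analytic_at f x0 -> locally x0 (ex_derive f) /\ analytic_at (Derive f) x0.
Proof.
  intros H. apply analytic_at_PSeries in H. destruct H as (s & Hr & Hs).
  assert (K : locally x0 (fun x => is_derive f x (PSeries (PS_derive s) (x - x0)))).
  { generalize (filter_and _ _ (locally_cv_radius s x0 Hr) (locally_locally _ _ Hs)).
    apply filter_imp. intros x [H1 H2].
    apply is_derive_ext_loc with (fun x => PSeries s (x - x0)).
    - revert H2. apply filter_imp. intros y Hy. now symmetry.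
    - now apply is_derive_PSeries_shift. }
  split.
  - revert K. apply filter_imp. intros x Hx. eexists. exact Hx.
  - apply analytic_at_PSeries. exists (PS_derive s). split.
    + now rewrite CV_radius_derive.
    + revert K. apply filter_imp. intros x Hx. now apply is_derive_unique.
Qed.

Lemma analytic_at_ex_derive (f : R -> R) (x0 : R) : analytic_at f x0 -> ex_derive f x0.
Proof. intros H. apply locally_singleton. now apply analytic_at_derive. Qed.

Lemma analytic_at_continuous (f : R -> R) (x0 : R) : analytic_at f x0 -> continuous f x0.
Proof. intros H. apply (ex_derive_continuous f). now apply analytic_at_ex_derive. Qed.

Lemma analytic_at_potential (g : R -> R) : analytic_at g 0 -> analytic_at (potential g) 0.
Proof.
  intros H. apply analytic_at_PSeries in H. destruct H as (s & Hr & Hs).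
  exists (PS_Int s).
  pose proof (locally_cv_radius s 0 Hr) as Hc.
  apply locally_R_iff in Hs. apply locally_R_iff in Hc.
  destruct Hs as (e & He & Hs). destruct Hc as (e' & He' & Hc).
  apply locally_R_iff. exists (Rmin e e'). split; [now apply Rmin_pos | ].
  intros x Hx. rewrite Rminus_0_r in *. unfold potential.
  rewrite (RInt_ext g (PSeries s)).
  - apply is_pseries_RInt. rewrite <- (Rminus_0_r x). apply Hc.
    rewrite Rminus_0_r. eapply Rlt_le_trans; [exact Hx | apply Rmin_r].
  - intros y Hy. rewrite <- (Rminus_0_r y) at 2. apply Hs.
    rewrite Rminus_0_r. apply Rlt_le_trans with (2 := Rmin_l e e').
    apply Rle_lt_trans with (2 := Hx).
    unfold Rmin, Rmax in Hy. destruct (Rle_dec 0 x); unfold Rabs; repeat destruct Rcase_abs; lra.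
Qed.

(** Pulls out a power of [x]; the cofactor is the sum of the shifted series. This yields signs near
    0 in [analytic_at_trichotomy] and the limit of G/g^2 in [ext_quotient_continuous_0]. *)
Lemma PSeries_factor (f : R -> R) (s : nat -> R) (n : nat) :
  Rbar_lt 0 (CV_radius s) -> locally 0 (fun x => f x = PSeries s (x - 0)) ->
  (forall k, (k < n)%nat -> s k = 0) ->
  exists q, continuous q 0 /\ q 0 = s n /\ locally 0 (fun x => f x = x ^ n * q x).
Proof.
  intros Hr Hs Hlow. exists (PSeries (PS_decr_n s n)). split; [ | split].
  - apply continuity_pt_filterlim. apply PSeries_continuity.
    rewrite Rabs_R0. now apply CV_radius_decr_n_pos.
  - rewrite PSeries_0. unfold PS_decr_n. f_equal. lia.
  - revert Hs. apply filter_imp. intros x ->. rewrite Rminus_0_r.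
    now apply PSeries_decr_n_aux.
Qed.

(** If some coefficient is nonzero, let [n] be the least index of one: then [f x = x ^ n * q x] with
    [q 0 = s n <> 0], and by continuity [q] keeps the sign of [s n] near 0. The sign is claimed to
    the right of 0 only, as [x ^ n] changes sign for odd [n]. *)
Lemma analytic_at_trichotomy (f : R -> R) :
  analytic_at f 0 ->
  locally 0 (fun x => f x = 0) \/
  exists e, 0 < e /\
    ((forall x, 0 < x < e -> 0 < f x) \/ (forall x, 0 < x < e -> f x < 0)).
Proof.
  intros H. apply analytic_at_PSeries in H. destruct H as (s & Hr & Hs).
  destruct (classic (forall n, s n = 0)) as [Hz | Hnz].
  - left. revert Hs. apply filter_imp. intros x Hx. rewrite Hx.
    rewrite (PSeries_ext s (fun _ => 0) (x - 0) Hz). apply PSeries_const_0.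
  - right.
    assert (Hex : exists n, s n <> 0) by now apply not_all_ex_not.
    destruct (dec_inh_nat_subset_has_unique_least_element (fun n => s n <> 0))
      as (n & (Hn & Hmin) & _); [intros n; apply classic | exact Hex | ].
    assert (Hlow : forall k, (k < n)%nat -> s k = 0).
    { intros k Hk. apply NNPP. intros C. apply Hmin in C. lia. }
    destruct (PSeries_factor f s n Hr Hs Hlow) as (q & Hcont & Hv & Hf).
    assert (Hpos : 0 < Rabs (s n)) by now apply Rabs_pos_lt.
    assert (Hb : locally 0 (fun x => Rabs (q x - s n) < Rabs (s n))).
    { apply (Hcont (fun y => Rabs (y - s n) < Rabs (s n))).
      apply locally_R_iff. exists (Rabs (s n)). split; [exact Hpos | ].
      intros y. now rewrite Hv. }
    generalize (filter_and _ _ Hf Hb). intros K. apply locally_R_iff in K.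
    destruct K as (e & He & K). exists e. split; [exact He | ].
    assert (E : forall x, 0 < x < e -> f x = x ^ n * q x /\ Rabs (q x - s n) < Rabs (s n) /\ 0 < x ^ n).
    { intros x Hx. destruct (K x) as [K1 K2].
      - rewrite Rminus_0_r, Rabs_pos_eq; lra.
      - split; [exact K1 | split; [exact K2 | apply pow_lt; lra]]. }
    destruct (Rdichotomy _ _ Hn) as [Hneg | Hps]; [right | left];
      intros x Hx; destruct (E x Hx) as (-> & E1 & E2);
      revert E1; unfold Rabs; repeat destruct Rcase_abs; intros E1; nra.
Qed.

(** * Inverse functions and uniqueness of solutions *)


Lemma ex_RInt_continuity (p : R -> R) (a b : R) :
  (forall x, continuous p x) -> ex_RInt p a b.
Proof. intros H. apply (ex_RInt_continuous (V := R_CompleteNormedModule)). intros; apply H. Qed.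

Lemma is_derive_primitive (p : R -> R) (x : R) :
  (forall x, continuous p x) -> is_derive (RInt p 0) x (p x).
Proof.
  intros H. apply (is_derive_RInt p (RInt p 0) 0 x); [ | apply H].
  apply filter_forall. intros y. apply (RInt_correct (V := R_CompleteNormedModule)).
  now apply ex_RInt_continuity.
Qed.

Lemma derive_MVT (f df : R -> R) (x y : R) :
  (forall z, is_derive f z (df z)) -> exists z, Rmin x y <= z <= Rmax x y /\ f y - f x = df z * (y - x).
Proof.
  intros H. apply MVT_gen; intros z _; [apply H | ].
  apply continuity_pt_filterlim. apply (ex_derive_continuous f). eexists; apply H.
Qed.

Lemma derive_0_const (f : R -> R) (x y : R) :
  (forall z, is_derive f z 0) -> f x = f y.
Proof.
  intros H. destruct (derive_MVT f (fun _ => 0) x y H) as (z & _ & E). lra.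
Qed.

Lemma derive_ge_incr (f df : R -> R) (m x y : R) :
  (forall z, is_derive f z (df z)) -> (forall z, m <= df z) -> x <= y ->
  m * (y - x) <= f y - f x.
Proof.
  intros H Hm Hxy. destruct (derive_MVT f df x y H) as (z & _ & ->).
  specialize (Hm z). nra.
Qed.

(** The lower bound [m] on the slope makes [f] onto and one-to-one, and makes its inverse Lipschitz
    with constant [/ m]; the last fact lets the difference quotients of the inverse converge. *)
Lemma global_inverse (f df : R -> R) (m : R) :
  (forall z, is_derive f z (df z)) -> 0 < m -> (forall z, m <= df z) ->
  exists h, (forall u, f (h u) = u) /\ (forall x, h (f x) = x) /\
    forall u, is_derive h u (/ df (h u)).
Proof.
  intros Hd Hm Hdf.
  assert (Hc : continuity f).
  { intros z. apply continuity_pt_filterlim. apply (ex_derive_continuous f). eexists; apply Hd. }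
  assert (Hsurj : forall u, {x | f x = u}).
  (* With slope at least [m], moving by [M] to either side of 0 changes [f] by at least [m * M],
     which exceeds the distance from [f 0] to [u]; so [u] lies between [f (- M)] and [f M]. *)
  { intros u. set (M := Rabs (u - f 0) / m + 1).
    assert (HM : 0 < M).
    { unfold M. pose proof (Rabs_pos (u - f 0)).
      pose proof (Rdiv_le_0_compat (Rabs (u - f 0)) m). lra. }
    assert (HmM : Rabs (u - f 0) < m * M) by (unfold M; field_simplify; lra).
    pose proof (derive_ge_incr f df m 0 M Hd Hdf ltac:(lra)).
    pose proof (derive_ge_incr f df m (- M) 0 Hd Hdf ltac:(lra)).
    destruct (IVT (fun x => f x - u) (- M) M) as (z & _ & Hz).
    - apply continuity_minus; [exact Hc | apply continuity_const; now intros ? ?].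
    - lra.
    - revert HmM. unfold Rabs. destruct Rcase_abs; lra.
    - revert HmM. unfold Rabs. destruct Rcase_abs; lra.
    - exists z. lra. }
  assert (Hinj : forall x y, m * Rabs (y - x) <= Rabs (f y - f x)).
  { intros x y. destruct (derive_MVT f df x y Hd) as (z & _ & ->).
    rewrite Rabs_mult. apply Rmult_le_compat_r; [apply Rabs_pos | ].
    apply Rle_trans with (2 := Rle_abs _). apply Hdf. }
  assert (Hex : exists h, forall u, f (h u) = u).
  { exists (fun u => proj1_sig (Hsurj u)). intros u. exact (proj2_sig (Hsurj u)). }
  destruct Hex as [h Hfh]. exists h.
  assert (Hhf : forall x, h (f x) = x).
  { intros x. pose proof (Hinj x (h (f x))) as K. rewrite Hfh in K.
    rewrite Rminus_diag, Rabs_R0 in K.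
    destruct (Req_dec (h (f x)) x) as [E | E]; [exact E | exfalso].
    assert (0 < Rabs (h (f x) - x)) by (apply Rabs_pos_lt; lra). nra. }
  split; [exact Hfh | split; [exact Hhf | ]].
  intros u.
  assert (Hlip : forall v, Rabs (h v - h u) <= Rabs (v - u) / m).
  { intros v. pose proof (Hinj (h u) (h v)) as K. rewrite !Hfh in K.
    apply Rle_div_r; [exact Hm | lra]. }
  (* The error term of the derivative of [f] at [h u], transported through the
     Lipschitz bound on [h]. *)
  apply is_derive_Reals. intros eps Heps.
  set (x := h u) in *. pose proof (Hdf x) as Hx.
  pose proof (proj1 (is_derive_Reals f x (df x)) (Hd x)) as D.
  assert (Hdx : 0 < df x) by lra.
  (* The factor [df x] makes up for the division by [df x] below, and [m] for the Lipschitz constant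
     [/ m]. *)
  assert (He' : 0 < eps * df x * m) by (apply Rmult_lt_0_compat; [apply Rmult_lt_0_compat | ]; lra).
  destruct (D _ He') as [del Hdel].
  assert (Hdm : 0 < del * m) by (apply Rmult_lt_0_compat; [apply cond_pos | lra]).
  exists (mkposreal _ Hdm). intros k Hk0 Hk. simpl in Hk.
  set (y := h (u + k)).
  pose proof (Hlip (u + k)) as L. fold y in L.
  replace (u + k - u) with k in L by ring.
  assert (Hne : y - x <> 0).
  { intros C. apply Hk0. assert (y = x) by lra.
    assert (f y = f x) by now f_equal. unfold y, x in H0. rewrite !Hfh in H0. lra. }
  assert (Hsm : Rabs (y - x) < del).
  { apply Rle_lt_trans with (1 := L). apply Rlt_div_l; lra. }
  specialize (Hdel (y - x) Hne Hsm).
  replace (x + (y - x)) with y in Hdel by ring.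
  assert (Ek : f y - f x = k) by (unfold y, x; rewrite !Hfh; ring).
  rewrite Ek in Hdel.
  replace ((y - x) / k - / df x) with (- (k / (y - x) - df x) * ((y - x) / k) / df x)
    by (field; repeat split; lra).
  unfold Rdiv at 1. rewrite !Rabs_mult, Rabs_Ropp.
  rewrite (Rabs_pos_eq (/ df x)) by (left; now apply Rinv_0_lt_compat).
  assert (Hq : Rabs ((y - x) / k) <= / m).
  { unfold Rdiv. rewrite Rabs_mult, Rabs_inv.
    assert (0 < Rabs k) by now apply Rabs_pos_lt.
    apply Rle_trans with (Rabs k / m * / Rabs k).
    - apply Rmult_le_compat_r; [left; now apply Rinv_0_lt_compat | exact L].
    - right. field. lra. }
  apply Rmult_lt_reg_r with (df x); [exact Hdx | ].
  rewrite Rmult_assoc, Rinv_l, Rmult_1_r by lra.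
  apply Rle_lt_trans with (Rabs (k / (y - x) - df x) * / m).
  - apply Rmult_le_compat_l; [apply Rabs_pos | exact Hq].
  - apply Rmult_lt_reg_r with m; [exact Hm | ].
    rewrite Rmult_assoc, Rinv_l, Rmult_1_r by lra. exact Hdel.
Qed.

Lemma polar_angle (s c : R) : s ^ 2 + c ^ 2 = 1 -> exists t, sin t = s /\ cos t = c.
Proof.
  intros H.
  assert (Hc : -1 <= c <= 1) by nra.
  assert (Es : sin (acos c) = Rabs s).
  { rewrite sin_acos by exact Hc. rewrite <- sqrt_Rsqr_abs. f_equal. unfold Rsqr. nra. }
  destruct (Rle_dec 0 s) as [Hs | Hs].
  - exists (acos c). rewrite Es, Rabs_pos_eq by exact Hs. split; [reflexivity | now apply cos_acos].
  - exists (- acos c). rewrite sin_neg, cos_neg, Es, Rabs_left by lra.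
    split; [lra | now apply cos_acos].
Qed.

(** Otherwise [t / 2] lies in (0, PI), where the sine is positive, against cos t = 1 - 2 sin(t/2)^2.
    This is the source of the minimality of the periods found below. *)
Lemma cos_eq_1_ge_2PI (t : R) : 0 < t -> cos t = 1 -> 2 * PI <= t.
Proof.
  intros Ht Hc. destruct (Rle_lt_dec (2 * PI) t) as [H | H]; [exact H | exfalso].
  assert (K : 0 < sin (t / 2)) by (apply sin_gt_0; lra).
  replace t with (2 * (t / 2)) in Hc by field. rewrite cos_2a_sin in Hc. nra.
Qed.

Lemma bounded_on_segment (f : R -> R) (a b : R) :
  a <= b -> (forall x, continuous f x) -> exists M, 0 <= M /\ forall x, a <= x <= b -> Rabs (f x) <= M.
Proof.
  intros Hab Hf.
  destruct (continuity_ab_maj (fun x => Rabs (f x)) a b Hab) as (z & Hz & _).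
  - intros c _. apply continuity_pt_filterlim. apply (continuous_Rabs_comp f). apply Hf.
  - exists (Rabs (f z)). split; [apply Rabs_pos | exact Hz].
Qed.

Lemma is_solution_continuous (g x y : R -> R) :
  is_solution g x y -> (forall t, continuous x t) /\ (forall t, continuous y t).
Proof.
  intros H. split; intros t; destruct (H t) as [Hx Hy].
  - apply (ex_derive_continuous x). exists (y t). exact Hx.
  - apply (ex_derive_continuous y). exists (- g (x t)). exact Hy.
Qed.

(* Gronwall: [e^(-K t) D] is nonincreasing for the squared distance [D]. *)
Lemma is_solution_unique_forward (g x1 y1 x2 y2 : R -> R) :
  (forall x, ex_derive g x) -> (forall x, continuous (Derive g) x) ->
  is_solution g x1 y1 -> is_solution g x2 y2 -> x1 0 = x2 0 -> y1 0 = y2 0 ->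
  forall t, 0 <= t -> x1 t = x2 t /\ y1 t = y2 t.
Proof.
  intros Hg Hdg H1 H2 Ex Ey t Ht.
  destruct (is_solution_continuous _ _ _ H1) as [Cx1 _].
  destruct (is_solution_continuous _ _ _ H2) as [Cx2 _].
  destruct (bounded_on_segment x1 0 t Ht Cx1) as (M1 & HM1 & B1).
  destruct (bounded_on_segment x2 0 t Ht Cx2) as (M2 & HM2 & B2).
  (* Up to time [t] both orbits have their positions in this segment, and so do the mean value
     points between them; hence [L] is a Lipschitz constant for [g] there. *)
  destruct (bounded_on_segment (Derive g) (- (M1 + M2)) (M1 + M2)) as (L & HL & BL); [lra | exact Hdg | ].
  assert (Lip : forall s, 0 <= s <= t -> Rabs (g (x1 s) - g (x2 s)) <= L * Rabs (x1 s - x2 s)).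
  { intros s Hs. destruct (derive_MVT g (Derive g) (x2 s) (x1 s)) as (z & Hz & ->).
    - intros z. apply Derive_correct. apply Hg.
    - rewrite Rabs_mult. apply Rmult_le_compat_r; [apply Rabs_pos | ].
      apply BL. specialize (B1 s Hs). specialize (B2 s Hs).
      apply Rabs_le_between in B1. apply Rabs_le_between in B2.
      revert Hz. unfold Rmin, Rmax. destruct Rle_dec; lra. }
  set (D := fun s => (x1 s - x2 s) ^ 2 + (y1 s - y2 s) ^ 2).
  (* In the derivative of [D], the 1 pays for the product of the position and velocity differences
     and [L] for the force term, both through 2 |p q| <= p^2 + q^2. *)
  set (K := 1 + L).
  set (dD := fun s => 2 * (x1 s - x2 s) * (y1 s - y2 s) - 2 * (y1 s - y2 s) * (g (x1 s) - g (x2 s))).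
  assert (HD : forall s, is_derive (fun s => exp (- K * s) * D s) s (exp (- K * s) * (dD s - K * D s))).
  { intros s. destruct (H1 s) as [dx1 dy1]. destruct (H2 s) as [dx2 dy2].
    unfold D, dD. auto_derive.
    - repeat split; eexists; eassumption.
    - rewrite (is_derive_unique (fun x : R => x1 x) s _ dx1), (is_derive_unique (fun x : R => x2 x) s _ dx2),
        (is_derive_unique (fun x : R => y1 x) s _ dy1), (is_derive_unique (fun x : R => y2 x) s _ dy2). ring. }
  assert (Hle : exp (- K * t) * D t - exp (- K * 0) * D 0 <= 0).
  { destruct (MVT_gen (fun s => exp (- K * s) * D s) 0 t (fun s => exp (- K * s) * (dD s - K * D s)))
      as (z & Hz & E).
    - intros s _. apply HD.
    - intros s _. apply continuity_pt_filterlim.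
      apply (ex_derive_continuous (fun s => exp (- K * s) * D s)). eexists; apply HD.
    - cbv beta in E. rewrite E.
      rewrite Rmin_left, Rmax_right in Hz by exact Ht.
      specialize (Lip z Hz). pose proof (exp_pos (- K * z)).
      assert (dD z - K * D z <= 0).
      { unfold dD, D, K.
        set (p := x1 z - x2 z) in *. set (q := y1 z - y2 z) in *. set (w := g (x1 z) - g (x2 z)) in *.
        assert (Rabs q * Rabs w <= L * (Rabs p * Rabs q)) by (pose proof (Rabs_pos q); nra).
        assert (- (q * w) <= Rabs q * Rabs w) by (rewrite <- Rabs_mult, <- Rabs_Ropp; apply Rle_abs).
        assert (2 * (Rabs p * Rabs q) <= p ^ 2 + q ^ 2).
        { rewrite <- (pow2_abs p), <- (pow2_abs q). pose proof (pow2_ge_0 (Rabs p - Rabs q)). nra. }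
        assert (2 * (p * q) <= p ^ 2 + q ^ 2) by (pose proof (pow2_ge_0 (p - q)); nra).
        assert (L * (2 * (Rabs p * Rabs q)) <= L * (p ^ 2 + q ^ 2)) by (apply Rmult_le_compat_l; lra).
        lra. }
      assert (exp (- K * z) * (dD z - K * D z) <= 0) by nra.
      nra. }
  assert (D0 : D 0 = 0) by (unfold D; rewrite Ex, Ey; ring).
  rewrite D0 in Hle. pose proof (exp_pos (- K * t)).
  assert (D t <= 0) by nra.
  unfold D in H0.
  pose proof (pow2_ge_0 (x1 t - x2 t)). pose proof (pow2_ge_0 (y1 t - y2 t)).
  split; apply Rminus_diag_uniq, Rsqr_0_uniq; unfold Rsqr; lra.
Qed.

(** Time reversal carries uniqueness from positive to negative times. *)
Lemma is_solution_reverse (g x y : R -> R) :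
  is_solution g x y -> is_solution g (fun t => x (- t)) (fun t => - y (- t)).
Proof.
  intros H t. destruct (H (- t)) as [Hx Hy]. split.
  - auto_derive; [repeat split; eexists; exact Hx | ].
    rewrite (is_derive_unique (fun x0 : R => x x0) _ _ Hx). ring.
  - auto_derive; [repeat split; eexists; exact Hy | ].
    rewrite (is_derive_unique (fun x0 : R => y x0) _ _ Hy). ring.
Qed.

Lemma is_solution_unique (g x1 y1 x2 y2 : R -> R) :
  (forall x, ex_derive g x) -> (forall x, continuous (Derive g) x) ->
  is_solution g x1 y1 -> is_solution g x2 y2 -> x1 0 = x2 0 -> y1 0 = y2 0 ->
  forall t, x1 t = x2 t /\ y1 t = y2 t.
Proof.
  intros Hg Hdg H1 H2 Ex Ey t. destruct (Rle_dec 0 t) as [Ht | Ht].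
  - now apply (is_solution_unique_forward g).
  - destruct (is_solution_unique_forward g _ _ _ _ Hg Hdg
      (is_solution_reverse _ _ _ H1) (is_solution_reverse _ _ _ H2)) with (t := - t) as [E1 E2].
    + now rewrite Ropp_0.
    + now rewrite Ropp_0, Ey.
    + lra.
    + rewrite Ropp_involutive in *. split; lra.
Qed.

Lemma is_minimal_period_ext (x1 y1 x2 y2 : R -> R) (T1 T2 : R) :
  (forall t, x1 t = x2 t /\ y1 t = y2 t) ->
  is_minimal_period x1 y1 T1 -> is_minimal_period x2 y2 T2 -> T1 = T2.
Proof.
  intros E [P1 M1] [P2 M2]. apply Rle_antisym.
  - apply M1. destruct P2 as [HT2 P2]. split; [exact HT2 | ]. intros t.
    destruct (E t) as [-> ->]. destruct (E (t + T2)) as [-> ->]. apply P2.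
  - apply M2. destruct P1 as [HT1 P1]. split; [exact HT1 | ]. intros t.
    destruct (E t) as [<- <-]. destruct (E (t + T1)) as [<- <-]. apply P1.
Qed.

(** Half a period of a constant solution is again a period. This disposes of the origin, which
    belongs to the neighbourhood in [is_isochronous_center]. *)
Lemma constant_no_minimal_period (x y : R -> R) (T : R) :
  (forall t, x t = 0 /\ y t = 0) -> ~ is_minimal_period x y T.
Proof.
  intros E [[HT _] M]. assert (P : is_period x y (T / 2)).
  { split; [lra | ]. intros t. destruct (E t) as [-> ->]. apply E. }
  specialize (M _ P). lra.
Qed.

(** * Orbits and periods in the energy coordinate *)


(* [U] is the signed square root of [2 G], so that orbits become circles
   [U x ^ 2 + y ^ 2 = r ^ 2]; [p] is its derivative and [X] its inverse. *)
Record energy_coordinate (g : R -> R) (d : R) (p U X : R -> R) : Prop := {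
  ec_pos : 0 < d;
  ec_continuous : forall x, continuous p x;
  ec_bounds : forall x, 1 / 2 <= p x <= 2;
  ec_p0 : p 0 = 1;
  ec_derive : forall x, is_derive U x (p x);
  ec_U0 : U 0 = 0;
  ec_UX : forall u, U (X u) = u;
  ec_XU : forall x, X (U x) = x;
  ec_force : forall x, Rabs x <= d -> p x * U x = g x
}.

(** For h = X' this is the time of one turn on the circle of radius [r] in the plane of (U x, y),
    since dt = h (r sin phi) dphi along the orbit. *)
Definition period (h : R -> R) (r : R) : R := RInt (fun phi => h (r * sin phi)) 0 (2 * PI).

(** Only the even part of [h] contributes over a full turn; subtracting 1 removes the period 2 PI of
    the linear oscillator. *)
Definition even_excess (h : R -> R) (u : R) : R := (h u + h (- u)) / 2 - 1.

Lemma continuous_sin_comp (h : R -> R) (r : R) :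
  (forall u, continuous h u) -> forall phi, continuous (fun phi => h (r * sin phi)) phi.
Proof.
  intros Hh phi. apply (continuous_comp (fun phi => r * sin phi) h); [ | apply Hh].
  apply (ex_derive_continuous (fun phi => r * sin phi)). auto_derive. exact I.
Qed.

Lemma is_RInt_period (h : R -> R) (r : R) :
  (forall u, continuous h u) ->
  is_RInt (fun phi => h (r * sin phi)) 0 (2 * PI) (period h r).
Proof.
  intros Hh. apply (RInt_correct (V := R_CompleteNormedModule)).
  now apply ex_RInt_continuity, continuous_sin_comp.
Qed.

Lemma continuous_even_excess (h : R -> R) :
  (forall u, continuous h u) -> forall u, continuous (even_excess h) u.
Proof.
  intros Hh u. unfold even_excess.
  apply (continuous_minus (V := R_NormedModule)); [ | apply continuous_const].
  apply (continuous_mult (K := R_AbsRing)); [ | apply continuous_const].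
  apply (continuous_plus (V := R_NormedModule)); [apply Hh | ].
  apply (continuous_comp (fun u => - u) h); [ | apply Hh].
  apply (continuous_opp (V := R_NormedModule)). apply continuous_id.
Qed.

Lemma even_excess_opp (h : R -> R) (u : R) : even_excess h (- u) = even_excess h u.
Proof. unfold even_excess. rewrite Ropp_involutive. field. Qed.

(** Substitute 2 PI - phi for phi, which reverses the sign of the sine. *)
Lemma period_reflect (h : R -> R) (r : R) :
  (forall u, continuous h u) -> period (fun u => h (- u)) r = period h r.
Proof.
  intros Hh. unfold period.
  pose proof (RInt_comp_lin (V := R_CompleteNormedModule) (fun phi => h (r * sin phi)) (-1) (2 * PI) 0 (2 * PI)
    (ex_RInt_continuity _ _ _ (continuous_sin_comp h r Hh))) as E.
  replace (-1 * 0 + 2 * PI) with (2 * PI) in E by ring.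
  replace (-1 * (2 * PI) + 2 * PI) with 0 in E by ring.
  rewrite <- (opp_RInt_swap (V := R_CompleteNormedModule) (fun phi => h (r * sin phi)) 0 (2 * PI)) in E
    by now apply ex_RInt_continuity, continuous_sin_comp.
  rewrite RInt_scal in E.
  - change (-1 * RInt (fun y => h (r * sin (-1 * y + 2 * PI))) 0 (2 * PI) =
      - RInt (fun phi => h (r * sin phi)) 0 (2 * PI)) in E.
    transitivity (RInt (fun y => h (r * sin (-1 * y + 2 * PI))) 0 (2 * PI)); [ | lra].
    apply RInt_ext. intros x _. f_equal.
    replace (-1 * x + 2 * PI) with (- x + 2 * PI) by ring.
    rewrite sin_plus, sin_2PI, cos_2PI, sin_neg. ring.
  - apply ex_RInt_continuity. intros x.
    apply (continuous_comp (fun y => -1 * y + 2 * PI) (fun z => h (r * sin z))).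
    + apply (ex_derive_continuous (fun y => -1 * y + 2 * PI)). auto_derive. exact I.
    + now apply continuous_sin_comp.
Qed.

(** Since [h] and its reflection have equal integrals, [h] may be replaced by their mean, which is 1
    plus the excess. *)
Lemma period_excess (h : R -> R) (r : R) :
  (forall u, continuous h u) -> period h r = 2 * PI + period (even_excess h) r.
Proof.
  intros Hh.
  assert (Hh' : forall u, continuous (fun u : R => h (- u)) u).
  { intros u. apply (continuous_comp (fun u => - u) h); [ | apply Hh].
    apply (continuous_opp (V := R_NormedModule)). apply continuous_id. }
  pose proof (is_RInt_plus (V := R_NormedModule) _ _ _ _ _ _ (is_RInt_period h r Hh) (is_RInt_period _ r Hh')) as E.
  pose proof (is_RInt_scal (V := R_NormedModule) _ _ _ (1 / 2) _ E) as E2.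
  pose proof (is_RInt_minus (V := R_NormedModule) _ _ _ _ _ _ E2 (is_RInt_const (V := R_NormedModule) 0 (2 * PI) 1)) as E3.
  apply (is_RInt_unique (V := R_CompleteNormedModule)) in E3.
  rewrite (period_reflect h r Hh) in E3.
  assert (E4 : period (even_excess h) r =
    1 / 2 * (period h r + period h r) - (2 * PI - 0) * 1).
  { unfold period at 1.
    etransitivity; [ | exact E3]. apply RInt_ext. intros x _.
    unfold even_excess.
    change ((h (r * sin x) + h (- (r * sin x))) / 2 - 1 =
      1 / 2 * (h (r * sin x) + h (- (r * sin x))) - 1). field. }
  rewrite E4. field.
Qed.

(** On (0, PI) the argument r sin phi stays in (0, r]; on (PI, 2 PI) evenness brings it back
    there. *)
Lemma period_even_pos (k : R -> R) (r : R) :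
  (forall u, continuous k u) -> (forall u, k (- u) = k u) -> 0 < r ->
  (forall u, 0 < u <= r -> 0 < k u) -> 0 < period k r.
Proof.
  intros Hk Ev Hr Hp. pose proof PI_RGT_0 as HPI. unfold period.
  rewrite <- (RInt_Chasles (V := R_CompleteNormedModule) _ 0 PI (2 * PI))
    by now apply ex_RInt_continuity, continuous_sin_comp.
  apply Rplus_lt_0_compat.
  - apply RInt_gt_0; [exact HPI | | intros; now apply continuous_sin_comp].
    intros x Hx. pose proof (sin_gt_0 x (proj1 Hx) (proj2 Hx)). pose proof (SIN_bound x).
    apply Hp. split; nra.
  - apply RInt_gt_0; [lra | | intros; now apply continuous_sin_comp].
    intros x Hx. pose proof (sin_lt_0 x (proj1 Hx) (proj2 Hx)). pose proof (SIN_bound x).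
    rewrite <- Ev. apply Hp. split; nra.
Qed.

Lemma period_bound (k : R -> R) (r eta : R) :
  (forall u, continuous k u) -> 0 < r -> (forall u, Rabs u <= r -> Rabs (k u) <= eta) ->
  Rabs (period k r) <= 2 * PI * eta.
Proof.
  intros Hk Hr Hb. pose proof PI_RGT_0 as HPI.
  replace (2 * PI * eta) with ((2 * PI - 0) * eta) by ring.
  apply abs_RInt_le_const; [lra | now apply ex_RInt_continuity, continuous_sin_comp | ].
  intros t _. apply Hb. rewrite Rabs_mult, (Rabs_pos_eq r) by lra.
  pose proof (SIN_bound t). assert (Rabs (sin t) <= 1) by (apply Rabs_le; lra). nra.
Qed.

Lemma period_opp (k : R -> R) (r : R) :
  (forall u, continuous k u) -> period (fun u => - k u) r = - period k r.
Proof.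
  intros Hk. unfold period.
  apply (RInt_opp (V := R_CompleteNormedModule)). now apply ex_RInt_continuity, continuous_sin_comp.
Qed.

(** A strict sign of the excess makes the period differ from 2 PI at every small radius, whereas the
    period tends to 2 PI with the radius, the excess being continuous and 0 at 0; so a constant
    period excludes a strict sign. As [h] is merely continuous here, the alternative between zero
    and strict sign is assumed; it is supplied later by an analytic function. *)
Lemma period_constant_iff (h : R -> R) :
  (forall u, continuous h u) -> h 0 = 1 ->
  (exists e, 0 < e /\ ((forall u, 0 < u < e -> even_excess h u = 0) \/
     (forall u, 0 < u < e -> 0 < even_excess h u) \/ (forall u, 0 < u < e -> even_excess h u < 0))) ->
  (exists T e, 0 < e /\ forall r, 0 < r < e -> period h r = T) <->
  (exists e, 0 < e /\ forall u, 0 < u < e -> even_excess h u = 0).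
Proof.
  intros Hh H0 Htri. pose proof PI_RGT_0 as HPI.
  set (k := even_excess h) in *.
  assert (Hk : forall u, continuous k u) by now apply continuous_even_excess.
  assert (Ev : forall u, k (- u) = k u) by (intros; apply even_excess_opp).
  assert (k0 : k 0 = 0) by (unfold k, even_excess; rewrite Ropp_0, H0; field).
  split.
  - intros (T & e & He & HT). destruct Htri as (e' & He' & [Hz | Hs]); [now exists e' | exfalso].
    set (m := Rmin e e' / 2).
    assert (Hm : 0 < m /\ m < e /\ m < e').
    { unfold m. pose proof (Rmin_pos e e' He He'). pose proof (Rmin_l e e'). pose proof (Rmin_r e e'). lra. }
    assert (HT' : forall r, 0 < r <= m -> period k r = T - 2 * PI).
    { intros r Hr. assert (E := period_excess h r Hh). fold k in E. rewrite (HT r) in E by lra. lra. }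
    assert (Hne : T - 2 * PI <> 0).
    { rewrite <- (HT' m) by lra. destruct Hs as [Hs | Hs].
      - apply Rgt_not_eq. apply period_even_pos; try easy. intros u Hu. apply Hs. lra.
      - assert (0 < period (fun u => - k u) m).
        { apply period_even_pos; try easy.
          - intros u. apply (continuous_opp (V := R_NormedModule)). apply Hk.
          - intros u. now rewrite Ev.
          - intros u Hu. assert (k u < 0) by (apply Hs; lra). lra. }
        rewrite period_opp in H by exact Hk. lra. }
    (* Chosen so that the bound [2 * PI * eta] is half the gap between [T] and 2 PI. *)
    set (eta := Rabs (T - 2 * PI) / (4 * PI)).
    assert (Heta : 0 < eta).
    { unfold eta. apply Rdiv_lt_0_compat; [now apply Rabs_pos_lt | lra]. }
    assert (L : locally 0 (fun u => Rabs (k u - k 0) < eta)).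
    { apply (Hk 0 (fun y => Rabs (y - k 0) < eta)). apply locally_R_iff. now exists eta. }
    apply locally_R_iff in L. destruct L as (f & Hf & L).
    set (r := Rmin m (f / 2)).
    assert (Hr : 0 < r /\ r <= m /\ r <= f / 2).
    { unfold r. split; [apply Rmin_pos; lra | split; [apply Rmin_l | apply Rmin_r]]. }
    assert (B : Rabs (period k r) <= 2 * PI * eta).
    { apply period_bound; [exact Hk | lra | ]. intros u Hu.
      specialize (L u). rewrite k0, !Rminus_0_r in L. left. apply L. lra. }
    rewrite HT' in B by lra. unfold eta in B.
    assert (2 * PI * (Rabs (T - 2 * PI) / (4 * PI)) = Rabs (T - 2 * PI) / 2) by (field; lra).
    pose proof (Rabs_pos_lt _ Hne). lra.
  - intros (e & He & Hz). exists (2 * PI), e. split; [exact He | ]. intros r Hr.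
    rewrite period_excess by exact Hh. fold k.
    assert (B : Rabs (period k r) <= 2 * PI * 0).
    { apply period_bound; [exact Hk | lra | ]. intros u Hu.
      destruct (Rtotal_order u 0) as [Hn | [Hn | Hn]].
      - rewrite <- Ev, Hz, Rabs_R0; [lra | ]. rewrite Rabs_left in Hu; lra.
      - rewrite Hn, k0, Rabs_R0. lra.
      - rewrite Hz, Rabs_R0; [lra | ]. rewrite Rabs_pos_eq in Hu; lra. }
    rewrite Rmult_0_r in B. pose proof (Rabs_pos (period k r)).
    assert (period k r = 0) by (destruct (Req_dec (period k r) 0) as [ | C]; [assumption | apply Rabs_pos_lt in C; lra]).
    lra.
Qed.

Lemma locally_R2_iff (P : R * R -> Prop) :
  locally ((0, 0) : R * R) P <->
  exists e, 0 < e /\ forall x y, Rabs x < e -> Rabs y < e -> P (x, y).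
Proof.
  split.
  - intros [e He]. exists e. split; [apply cond_pos | ]. intros x y Hx Hy. apply He.
    split; unfold ball; simpl; unfold AbsRing_ball; simpl; unfold abs, minus, plus, opp; simpl;
      rewrite Ropp_0, Rplus_0_r; assumption.
  - intros (e & He & H). exists (mkposreal e He). intros [x y] [Hx Hy].
    unfold ball in Hx, Hy; simpl in Hx, Hy. unfold AbsRing_ball, abs, minus, plus, opp in Hx, Hy.
    simpl in Hx, Hy. rewrite Ropp_0, Rplus_0_r in Hx, Hy. now apply H.
Qed.

(** * Explicit orbits and their minimal periods *)

Section EnergyCoordinate.

Context (g : R -> R) (d : R) (p U X : R -> R) (E : energy_coordinate g d p U X).

Let h (u : R) : R := / p (X u).

(** [global_inverse] provides a differentiable inverse of [U], and two inverses of [U] agree. *)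
Lemma energy_coordinate_X_derive (u : R) : is_derive X u (h u).
Proof.
  destruct (global_inverse U p (1 / 2)) as (X' & H1 & H2 & H3).
  - apply (ec_derive _ _ _ _ _ E).
  - lra.
  - apply (ec_bounds _ _ _ _ _ E).
  - assert (EX : forall u, X' u = X u).
    { intros v. rewrite <- (ec_UX _ _ _ _ _ E v) at 1. apply H2. }
    unfold h. rewrite <- EX. apply (is_derive_ext X' X); [exact EX | apply H3].
Qed.

Lemma energy_coordinate_h_bounds (u : R) : 1 / 2 <= h u <= 2.
Proof.
  unfold h. destruct (ec_bounds _ _ _ _ _ E (X u)) as [B1 B2]. split.
  - replace (1 / 2) with (/ 2) by field. apply Rinv_le_contravar; lra.
  - replace 2 with (/ (1 / 2)) by field. apply Rinv_le_contravar; lra.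
Qed.

Lemma energy_coordinate_X_continuous (u : R) : continuous X u.
Proof. apply (ex_derive_continuous X). exists (h u). apply energy_coordinate_X_derive. Qed.

Lemma energy_coordinate_h_continuous (u : R) : continuous h u.
Proof.
  unfold h. apply continuous_Rinv_comp.
  - apply (continuous_comp X p); [apply energy_coordinate_X_continuous | apply (ec_continuous _ _ _ _ _ E)].
  - pose proof (ec_bounds _ _ _ _ _ E (X u)). lra.
Qed.

Lemma energy_coordinate_X0 : X 0 = 0.
Proof. rewrite <- (ec_U0 _ _ _ _ _ E) at 1. apply (ec_XU _ _ _ _ _ E). Qed.

(** This bound and the next one serve to pass between neighbourhoods of 0 in x and in u = U x. *)
Lemma energy_coordinate_X_le (u : R) : Rabs (X u) <= 2 * Rabs u.
Proof.
  destruct (derive_MVT X h 0 u energy_coordinate_X_derive) as (z & _ & Hz).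
  rewrite energy_coordinate_X0, !Rminus_0_r in Hz. rewrite Hz, Rabs_mult.
  apply Rmult_le_compat_r; [apply Rabs_pos | ].
  pose proof (energy_coordinate_h_bounds z). apply Rabs_le. lra.
Qed.

Lemma energy_coordinate_U_le (x : R) : Rabs (U x) <= 2 * Rabs x.
Proof.
  destruct (derive_MVT U p 0 x (ec_derive _ _ _ _ _ E)) as (z & _ & Hz).
  rewrite (ec_U0 _ _ _ _ _ E), !Rminus_0_r in Hz. rewrite Hz, Rabs_mult.
  apply Rmult_le_compat_r; [apply Rabs_pos | ].
  pose proof (ec_bounds _ _ _ _ _ E z). apply Rabs_le. lra.
Qed.

(* With [x = X (r sin theta)], [y = r cos theta] the system reduces to
   [theta' = 1 / h (r sin theta)], which is solved by inverting an integral. *)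
Lemma energy_coordinate_orbit (r x0 y0 : R) :
  0 < r -> 2 * r <= d -> U x0 ^ 2 + y0 ^ 2 = r ^ 2 ->
  exists x y, is_solution g x y /\ x 0 = x0 /\ y 0 = y0 /\ is_minimal_period x y (period h r).
Proof.
  intros Hr Hrd Hc.
  set (w := fun phi => h (r * sin phi)).
  assert (Hw : forall phi, continuous w phi)
    by (apply continuous_sin_comp; apply energy_coordinate_h_continuous).
  assert (Hwb : forall phi, 1 / 2 <= w phi <= 2) by (intros; apply energy_coordinate_h_bounds).
  (* [tau phi] is the time needed to go from angle 0 to angle [phi]; its inverse [Th] gives the
     angle as a function of time. *)
  set (tau := RInt w 0 : R -> R).
  assert (Htau : forall phi, is_derive tau phi (w phi)) by (intros; now apply is_derive_primitive).
  assert (tau0 : tau 0 = 0) by apply (RInt_point (V := R_CompleteNormedModule)).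
  set (T := period h r).
  assert (HT : forall phi, tau (phi + 2 * PI) = tau phi + T).
  { intros phi.
    pose proof (derive_0_const (fun phi => tau (phi + 2 * PI) - tau phi) phi 0) as K.
    cbv beta in K. rewrite Rplus_0_l in K. change (tau (2 * PI)) with T in K.
    cut (tau (phi + 2 * PI) - tau phi = T - tau 0); [rewrite tau0; lra | apply K].
    intros z.
    replace 0 with (1 * w (z + 2 * PI) - w z).
    - apply (is_derive_minus (V := R_NormedModule)); [ | apply Htau].
      apply (is_derive_comp tau (fun z => z + 2 * PI)); [apply Htau | ].
      auto_derive; [exact I | ring].
    - unfold w. rewrite sin_plus, sin_2PI, cos_2PI. rewrite Rmult_1_l.
      replace (sin z * 1 + cos z * 0) with (sin z) by ring. ring. }
  destruct (global_inverse tau w (1 / 2) Htau) as (Th & HtauTh & HThtau & HTh); [lra | apply Hwb | ].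
  destruct (polar_angle (U x0 / r) (y0 / r)) as (th0 & Hs0 & Hc0).
  { replace ((U x0 / r) ^ 2 + (y0 / r) ^ 2) with ((U x0 ^ 2 + y0 ^ 2) / r ^ 2) by (field; lra).
    rewrite Hc. field. lra. }
  (* Shifting time by [t0] places the prescribed initial point at time 0. *)
  set (t0 := tau th0 : R).
  exists (fun t => X (r * sin (Th (t + t0)))), (fun t => r * cos (Th (t + t0))).
  assert (Hshift : forall t, Th (t + T + t0) = Th (t + t0) + 2 * PI).
  { intros t. rewrite <- (HThtau (Th (t + t0) + 2 * PI)), HT, HtauTh. f_equal. ring. }
  split; [intros t; split | split; [ | split; [ | split; [split; [ | intros t; split] | ]]]].
  - set (u := r * sin (Th (t + t0))).
    replace (r * cos (Th (t + t0))) with (/ w (Th (t + t0)) * (r * cos (Th (t + t0))) * h u).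
    + apply (is_derive_comp X (fun t => r * sin (Th (t + t0))) t (h u)
        (/ w (Th (t + t0)) * (r * cos (Th (t + t0))))); [apply energy_coordinate_X_derive | ].
      auto_derive; [eexists; apply HTh | ].
      rewrite (is_derive_unique (fun x : R => Th x) _ _ (HTh _)). ring.
    + change (w (Th (t + t0))) with (h u). field.
      pose proof (energy_coordinate_h_bounds u). lra.
  - set (u := r * sin (Th (t + t0))).
    change (is_derive (fun t => r * cos (Th (t + t0))) t (- g (X u))).
    rewrite <- (ec_force _ _ _ _ _ E), (ec_UX _ _ _ _ _ E).
    + auto_derive; [eexists; apply HTh | ].
      rewrite (is_derive_unique (fun x : R => Th x) _ _ (HTh _)).
      change (w (Th (t + t0))) with (/ p (X u)). rewrite Rinv_inv. unfold u. ring.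
    (* The orbit stays where [ec_force] holds: |X u| <= 2 |u| <= 2 r <= d. *)
    + apply Rle_trans with (1 := energy_coordinate_X_le u).
      unfold u. rewrite Rabs_mult, (Rabs_pos_eq r) by lra.
      pose proof (SIN_bound (Th (t + t0))).
      assert (Rabs (sin (Th (t + t0))) <= 1) by (apply Rabs_le; lra). nra.
  - rewrite Rplus_0_l. unfold t0. rewrite HThtau, Hs0.
    replace (r * (U x0 / r)) with (U x0) by (field; lra). apply (ec_XU _ _ _ _ _ E).
  - rewrite Rplus_0_l. unfold t0. rewrite HThtau, Hc0. field. lra.
  - pose proof PI_RGT_0.
    pose proof (derive_ge_incr tau w (1 / 2) 0 (2 * PI) Htau (fun z => proj1 (Hwb z)) ltac:(lra)) as K.
    change (tau (2 * PI)) with T in K. lra.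
  - rewrite Hshift, sin_plus, sin_2PI, cos_2PI. f_equal. ring.
  - rewrite Hshift, cos_plus, sin_2PI, cos_2PI. ring.
  (* At time [- t0] the angle is 0 and y = r. One period [T'] later y = r again, so
     [cos (Th T') = 1]; the angle has then advanced by at least 2 PI, which takes at least the time
     [T]. *)
  - intros T' [HT' HP]. destruct (HP (- t0)) as [HPx HPy].
    replace (- t0 + T' + t0) with T' in HPx, HPy by ring.
    replace (- t0 + t0) with 0 in HPx, HPy by ring.
    assert (Th0 : Th 0 = 0) by (rewrite <- tau0 at 1; apply HThtau).
    rewrite Th0, cos_0 in HPy.
    assert (Hcos : cos (Th T') = 1) by (apply Rmult_eq_reg_l with r; lra).
    assert (Hpos : 0 < Th T').
    { destruct (Rlt_le_dec 0 (Th T')) as [ | C]; [assumption | exfalso].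
      pose proof (derive_ge_incr tau w (1 / 2) _ _ Htau (fun z => proj1 (Hwb z)) C) as K.
      rewrite HtauTh, tau0 in K. lra. }
    pose proof (derive_ge_incr tau w (1 / 2) _ _ Htau (fun z => proj1 (Hwb z)) (cos_eq_1_ge_2PI _ Hpos Hcos)) as K.
    pose proof (cos_eq_1_ge_2PI _ Hpos Hcos).
    rewrite HtauTh in K. change (tau (2 * PI)) with T in K. lra.
Qed.

(** As |U x0| <= 2 |x0|, the sum of squares is below (4 + 1)/9 of rho^2, whence the divisor 3. It is
    positive because [U] vanishes only at 0. *)
Lemma energy_coordinate_radius (rho x0 y0 : R) :
  Rabs x0 < rho / 3 -> Rabs y0 < rho / 3 -> (x0, y0) <> (0, 0) ->
  exists r, 0 < r < rho /\ U x0 ^ 2 + y0 ^ 2 = r ^ 2.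
Proof.
  intros Hx Hy Hne. exists (sqrt (U x0 ^ 2 + y0 ^ 2)).
  pose proof (energy_coordinate_U_le x0) as HU.
  assert (Hpos : 0 < U x0 ^ 2 + y0 ^ 2).
  { destruct (Req_dec (U x0) 0) as [E0 | E0].
    - assert (x0 = 0) by (rewrite <- (ec_XU _ _ _ _ _ E x0), E0; apply energy_coordinate_X0).
      assert (y0 <> 0) by (intros C; apply Hne; now f_equal).
      pose proof (pow2_gt_0 y0 H0). pose proof (pow2_ge_0 (U x0)). lra.
    - pose proof (pow2_gt_0 (U x0) E0). pose proof (pow2_ge_0 y0). lra. }
  split; [split | ].
  - now apply sqrt_lt_R0.
  - pose proof (Rabs_pos x0). pose proof (Rabs_pos y0). pose proof (Rabs_pos (U x0)).
    rewrite <- (sqrt_pow2 rho) by lra. apply sqrt_lt_1_alt. split; [lra | ].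
    rewrite <- (pow2_abs (U x0)), <- (pow2_abs y0). nra.
  - symmetry. apply pow2_sqrt. lra.
Qed.

(** Every small radius [r] is realized by the point (X r, 0). Conversely, uniqueness identifies each
    solution starting near but not at the origin with an explicit orbit, whose minimal period is
    known. *)
Lemma isochronous_iff_period_constant :
  (forall x, ex_derive g x) -> (forall x, continuous (Derive g) x) -> g 0 = 0 ->
  is_isochronous_center g <-> exists T e, 0 < e /\ forall r, 0 < r < e -> period h r = T.
Proof.
  intros Hg Hdg g0. pose proof (ec_pos _ _ _ _ _ E) as Hd. split.
  - intros [_ (T & HT)]. apply locally_R2_iff in HT. destruct HT as (e & He & HT).
    exists T, (Rmin (e / 2) (d / 2)). split; [apply Rmin_pos; lra | ].
    intros r [Hr Hr']. pose proof (Rmin_l (e / 2) (d / 2)). pose proof (Rmin_r (e / 2) (d / 2)).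
    destruct (energy_coordinate_orbit r (X r) 0) as (x & y & Hs & Hx & Hy & Hp).
    + exact Hr.
    + lra.
    + rewrite (ec_UX _ _ _ _ _ E). ring.
    + apply (HT (X r) 0) with x y.
      * pose proof (energy_coordinate_X_le r) as K. rewrite (Rabs_pos_eq r) in K by lra. lra.
      * now rewrite Rabs_R0.
      * exact Hs.
      * now rewrite Hx, Hy.
      * exact Hp.
  - intros (T & e & He & HT).
    assert (Hb : forall x0 y0, Rabs x0 < Rmin e (d / 2) / 3 -> Rabs y0 < Rmin e (d / 2) / 3 ->
      (x0, y0) <> (0, 0) ->
      exists x y, is_solution g x y /\ x 0 = x0 /\ y 0 = y0 /\ is_minimal_period x y T).
    { intros x0 y0 Hx Hy Hne.
      destruct (energy_coordinate_radius _ _ _ Hx Hy Hne) as (r & [Hr Hr'] & Hc).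
      pose proof (Rmin_l e (d / 2)). pose proof (Rmin_r e (d / 2)).
      rewrite <- (HT r) by lra. apply energy_coordinate_orbit; [exact Hr | lra | exact Hc]. }
    assert (Hm : 0 < Rmin e (d / 2) / 3).
    { pose proof (Rmin_pos e (d / 2) He ltac:(lra)). lra. }
    split; [split; [exact g0 | ] | exists T]; apply locally_R2_iff;
      exists (Rmin e (d / 2) / 3); (split; [exact Hm | intros x0 y0 Hx Hy]).
    + intros Hne. destruct (Hb x0 y0 Hx Hy Hne) as (x & y & Hs & Ex & Ey & Hp).
      exists x, y, T. rewrite Ex, Ey. now split; [ | split].
    + intros x y T' Hs Hxy Hp.
      destruct (classic ((x0, y0) = (0, 0))) as [Ez | Hne].
      * exfalso. revert Hp. apply constant_no_minimal_period.
        rewrite Ez in Hxy. injection Hxy as Ex Ey.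
        apply (is_solution_unique g x y (fun _ => 0) (fun _ => 0) Hg Hdg); [exact Hs | | exact Ex | exact Ey].
        intros t. rewrite g0, Ropp_0. split; apply is_derive_Reals, derivable_pt_lim_const.
      * destruct (Hb x0 y0 Hx Hy Hne) as (x' & y' & Hs' & Ex' & Ey' & Hp').
        injection Hxy as Ex Ey.
        apply (is_minimal_period_ext x y x' y'); [ | exact Hp | exact Hp'].
        apply (is_solution_unique g); congruence || assumption.
Qed.

End EnergyCoordinate.

(** * Existence of the energy coordinate *)


Lemma is_derive_potential (g : R -> R) (x : R) :
  (forall x, continuous g x) -> is_derive (potential g) x (g x).
Proof. exact (is_derive_primitive g x). Qed.

Lemma potential_0 (g : R -> R) : potential g 0 = 0.
Proof. apply (RInt_point (V := R_CompleteNormedModule)). Qed.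

Lemma ext_quotient_neq (g : R -> R) (x : R) :
  x <> 0 -> ext_quotient g x = potential g x / g x ^ 2.
Proof. intros Hx. unfold ext_quotient. now destruct Req_EM_T. Qed.

Lemma ext_quotient_0 (g : R -> R) : ext_quotient g 0 = 1 / 2.
Proof. unfold ext_quotient. now destruct Req_EM_T. Qed.

(** Write g = x q1 and G = x^2 q2 with q1(0) = 1 and q2(0) = 1/2; near 0 the quotient is q2 / q1^2,
    with value 1/2 at 0. *)
Lemma ext_quotient_continuous_0 (g : R -> R) :
  (forall x, analytic_at g x) -> g 0 = 0 -> Derive g 0 = 1 -> continuous (ext_quotient g) 0.
Proof.
  intros Hg g0 dg0.
  destruct (proj1 (analytic_at_PSeries g 0) (Hg 0)) as (s & Hr & Hs).
  assert (s0 : s 0%nat = 0).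
  { rewrite <- g0. apply locally_singleton in Hs. rewrite Hs, Rminus_0_r. symmetry. apply PSeries_0. }
  assert (s1 : s 1%nat = 1).
  { rewrite <- dg0. rewrite (Derive_ext_loc g (fun x => PSeries s (x - 0)) 0 Hs).
    etransitivity; [ | symmetry; apply is_derive_unique, is_derive_PSeries_shift;
      exact (locally_singleton _ _ (locally_cv_radius s 0 Hr))].
    rewrite Rminus_0_r, PSeries_0. unfold PS_derive. simpl. ring. }
  destruct (PSeries_factor g s 1 Hr Hs) as (q1 & C1 & V1 & E1).
  { intros k Hk. now replace k with 0%nat by lia. }
  assert (HG : locally 0 (fun x => potential g x = PSeries (PS_Int s) (x - 0))).
  { pose proof (filter_and _ _ Hs (locally_cv_radius s 0 Hr)) as L.
    apply locally_R_iff in L. destruct L as (e & He & L).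
    apply locally_R_iff. exists e. split; [exact He | ]. intros x Hx.
    unfold potential. rewrite (RInt_ext g (PSeries s)).
    - rewrite RInt_PSeries; [now rewrite Rminus_0_r | ].
      rewrite <- (Rminus_0_r x). now apply L.
    - intros y Hy. rewrite <- (Rminus_0_r y) at 2. apply L.
      rewrite Rminus_0_r in *. apply Rle_lt_trans with (2 := Hx).
      unfold Rmin, Rmax in Hy. destruct (Rle_dec 0 x); unfold Rabs; repeat destruct Rcase_abs; lra. }
  destruct (PSeries_factor (potential g) (PS_Int s) 2) as (q2 & C2 & V2 & E2).
  { now rewrite CV_radius_Int. }
  { exact HG. }
  { intros [ | [ | k]] Hk; [reflexivity | | lia]. unfold PS_Int. rewrite s0. simpl. field. }
  assert (V2' : q2 0 = 1 / 2) by (rewrite V2; unfold PS_Int; rewrite s1; simpl; field).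
  rewrite s1 in V1.
  assert (K : locally 0 (fun x => q2 x * / (q1 x * q1 x) = ext_quotient g x)).
  { assert (L : locally 0 (fun x => q1 x <> 0)).
    { apply (C1 (fun y => y <> 0)). apply locally_R_iff. exists 1. split; [lra | ].
      intros y Hy C. rewrite C, V1 in Hy. unfold Rabs in Hy. destruct Rcase_abs; lra. }
    generalize (filter_and _ _ L (filter_and _ _ E1 E2)). apply filter_imp.
    intros x (N & F1 & F2). destruct (Req_dec x 0) as [-> | Hx].
    + rewrite ext_quotient_0, V1, V2'. field.
    + rewrite ext_quotient_neq, F1, F2 by exact Hx. field. now split. }
  apply (continuous_ext_loc _ (fun x => q2 x * / (q1 x * q1 x))).
  - exact K.
  - apply (continuous_mult (K := R_AbsRing)); [exact C2 | ].
    apply continuous_Rinv_comp; [now apply (continuous_mult (K := R_AbsRing)) | ].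
    rewrite V1. lra.
Qed.

(** For [d > 0] this is the projection of the line onto [-d, d]. Composing with it extends local
    data to the whole line, so that [p] is continuous and bounded everywhere. *)
Definition clamp (d x : R) : R := (Rabs (x + d) - Rabs (x - d)) / 2.

Lemma clamp_le (d x : R) : 0 < d -> Rabs (clamp d x) <= d.
Proof. intros Hd. unfold clamp, Rabs. repeat destruct Rcase_abs; lra. Qed.

Lemma clamp_id (d x : R) : Rabs x <= d -> clamp d x = x.
Proof. unfold clamp, Rabs. repeat destruct Rcase_abs; lra. Qed.

Lemma clamp_continuous (d x : R) : continuous (clamp d) x.
Proof.
  unfold clamp. apply (continuous_mult (K := R_AbsRing)); [ | apply continuous_const].
  apply (continuous_minus (V := R_NormedModule)); apply continuous_Rabs_comp.
  - apply (continuous_plus (V := R_NormedModule)); [apply continuous_id | apply continuous_const].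
  - apply (continuous_minus (V := R_NormedModule)); [apply continuous_id | apply continuous_const].
Qed.

(** Differentiating the signed root of 2 G at 0 is avoided by constructing the derivative first: [p]
    is the inverse root of 2 G/g^2, continuous even at 0, and [U] is its primitive. That [U] is the
    signed root then follows on each side of 0 by comparing derivatives. *)
Lemma energy_coordinate_exists (g : R -> R) (a b : R) :
  (forall x, analytic_at g x) -> g 0 = 0 -> Derive g 0 = 1 -> a < 0 -> 0 < b ->
  (forall x, a < x < b -> x <> 0 -> 0 < x * g x) ->
  exists d p U X, energy_coordinate g d p U X /\ (forall x, Rabs x <= d -> a < x < b) /\
    forall x, Rabs x <= d -> U x ^ 2 = 2 * potential g x.
Proof.
  intros Hg g0 dg0 Ha Hb Hxg.
  assert (Cg : forall x, continuous g x) by (intros; now apply analytic_at_continuous).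
  assert (CG : forall x, continuous (potential g) x).
  { intros x. apply (ex_derive_continuous (potential g)). exists (g x). now apply is_derive_potential. }
  assert (Cq0 := ext_quotient_continuous_0 g Hg g0 dg0).
  (* The tolerance 3/8 puts 2 G/g^2 between 1/4 and 7/4, hence its root between 1/2 and 2. *)
  assert (L : locally 0 (fun x => Rabs (ext_quotient g x - 1 / 2) < 3 / 8)).
  { apply (Cq0 (fun y => Rabs (y - 1 / 2) < 3 / 8)). apply locally_R_iff. exists (3 / 8).
    split; [lra | ]. now rewrite ext_quotient_0. }
  apply locally_R_iff in L. destruct L as (e & He & L).
  set (d := Rmin (e / 2) (Rmin (- a / 2) (b / 2))).
  assert (Hd : 0 < d /\ d < e /\ d < - a /\ d < b).
  { unfold d. pose proof (Rmin_l (e / 2) (Rmin (- a / 2) (b / 2))).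
    pose proof (Rmin_r (e / 2) (Rmin (- a / 2) (b / 2))).
    pose proof (Rmin_l (- a / 2) (b / 2)). pose proof (Rmin_r (- a / 2) (b / 2)).
    split; [repeat apply Rmin_pos; lra | lra]. }
  assert (Hab : forall x, Rabs x <= d -> a < x < b).
  { intros x Hx. apply Rabs_le_between in Hx. lra. }
  assert (Hq : forall x, Rabs x <= d -> 1 / 8 < ext_quotient g x < 7 / 8).
  { intros x Hx. specialize (L x). rewrite Rminus_0_r in L.
    assert (K : Rabs (ext_quotient g x - 1 / 2) < 3 / 8) by (apply L; lra).
    apply Rabs_lt_between in K. lra. }
  assert (Hgx : forall x, Rabs x <= d -> x <> 0 -> g x <> 0).
  { intros x Hx Hne C. specialize (Hxg x (Hab x Hx) Hne). rewrite C in Hxg. lra. }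
  assert (Cq : forall x, Rabs x <= d -> continuous (ext_quotient g) x).
  { intros x Hx. destruct (Req_dec x 0) as [-> | Hne]; [exact Cq0 | ].
    apply (continuous_ext_loc _ (fun x => potential g x * / (g x * g x))).
    - apply locally_R_iff. exists (Rabs x). split; [now apply Rabs_pos_lt | ]. intros y Hy.
      assert (y <> 0).
      { intros ->. rewrite Rminus_0_l, Rabs_Ropp in Hy. lra. }
      rewrite ext_quotient_neq by assumption. unfold Rdiv. do 2 f_equal. ring.
    - apply (continuous_mult (K := R_AbsRing)); [apply CG | ].
      apply continuous_Rinv_comp; [apply (continuous_mult (K := R_AbsRing)); apply Cg | ].
      now apply Rmult_integral_contrapositive_currified; apply Hgx. }
  set (p := fun x => / sqrt (2 * ext_quotient g (clamp d x))).
  assert (Hs : forall x, 1 / 2 < sqrt (2 * ext_quotient g (clamp d x)) < 2).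
  { intros x. pose proof (Hq _ (clamp_le d x (proj1 Hd))) as K. split.
    - rewrite <- (sqrt_pow2 (1 / 2)) by lra. apply sqrt_lt_1_alt. lra.
    - rewrite <- (sqrt_pow2 2) at 2 by lra. apply sqrt_lt_1_alt. lra. }
  assert (Cp : forall x, continuous p x).
  { intros x. unfold p. apply continuous_Rinv_comp; [ | specialize (Hs x); lra].
    apply continuous_sqrt_comp. apply (continuous_mult (K := R_AbsRing)); [apply continuous_const | ].
    apply (continuous_comp (clamp d) (ext_quotient g)); [apply clamp_continuous | ].
    apply Cq. now apply clamp_le. }
  assert (Bp : forall x, 1 / 2 <= p x <= 2).
  { intros x. specialize (Hs x). unfold p. split.
    - replace (1 / 2) with (/ 2) by field. apply Rinv_le_contravar; lra.
    - replace 2 with (/ (1 / 2)) at 2 by field. apply Rinv_le_contravar; lra. }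
  set (U := RInt p 0 : R -> R).
  assert (dU : forall x, is_derive U x (p x)) by (intros; now apply is_derive_primitive).
  assert (U0 : U 0 = 0) by apply (RInt_point (V := R_CompleteNormedModule)).
  destruct (global_inverse U p (1 / 2) dU ltac:(lra) (fun z => proj1 (Bp z))) as (X & HUX & HXU & _).
  assert (HG : forall x, Rabs x <= d -> x <> 0 -> 0 < potential g x).
  { intros x Hx Hne. pose proof (Hq x Hx) as K. rewrite ext_quotient_neq in K by exact Hne.
    pose proof (pow2_gt_0 (g x) (Hgx x Hx Hne)).
    replace (potential g x) with (potential g x / g x ^ 2 * g x ^ 2) by (field; now apply Hgx). nra. }
  assert (Hp : forall x, Rabs x <= d -> x <> 0 -> p x = Rabs (g x) / sqrt (2 * potential g x)).
  { intros x Hx Hne. unfold p. rewrite clamp_id, ext_quotient_neq by assumption.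
    pose proof (HG x Hx Hne). pose proof (pow2_gt_0 (g x) (Hgx x Hx Hne)).
    replace (2 * (potential g x / g x ^ 2)) with (2 * potential g x / (g x ^ 2)) by (field; now apply Hgx).
    rewrite sqrt_div_alt by assumption.
    rewrite <- (pow2_abs (g x)), sqrt_pow2 by apply Rabs_pos.
    rewrite Rinv_div. reflexivity. }
  (* [sg] is the sign of [x], which treats both half-lines at once. The root is differentiated only
     strictly between 0 and [x]; at 0 the mean value theorem asks only for continuity. *)
  assert (HU : forall sg x, sg = 1 \/ sg = -1 -> 0 < sg * x <= d -> U x = sg * sqrt (2 * potential g x)).
  { intros sg x Hsg Hx.
    assert (Hz : forall z, 0 < sg * z <= d -> Rabs z <= d /\ z <> 0 /\ Rabs (g z) = sg * g z).
    { intros z Hz. assert (Hzd : Rabs z <= d) by (apply Rabs_le; destruct Hsg; subst; lra).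
      assert (Hz0 : z <> 0) by (intros ->; lra).
      split; [exact Hzd | split; [exact Hz0 | ]].
      specialize (Hxg z (Hab z Hzd) Hz0).
      destruct Hsg; subst; [rewrite Rabs_pos_eq by nra | rewrite Rabs_left by nra]; ring. }
    destruct (MVT_gen (fun z => U z - sg * sqrt (2 * potential g z)) 0 x (fun _ => 0)) as (z & _ & Ez).
    - intros z Hz'.
      assert (Hzx : 0 < sg * z <= d).
      { revert Hz'. unfold Rmin, Rmax. destruct Rle_dec; destruct Hsg; subst; lra. }
      destruct (Hz z Hzx) as (H1 & H2 & H3). pose proof (HG z H1 H2).
      assert (0 < sqrt (2 * potential g z)) by (apply sqrt_lt_R0; lra).
      replace 0 with (p z - sg * (2 * g z / (2 * sqrt (2 * potential g z)))).
      + apply (is_derive_minus (V := R_NormedModule)); [apply dU | ].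
        apply (is_derive_scal (fun z => sqrt (2 * potential g z))).
        apply (is_derive_sqrt (fun z => 2 * potential g z)); [ | lra].
        apply (is_derive_scal (potential g) z 2). now apply is_derive_potential.
      + rewrite (Hp z H1 H2), H3. field. lra.
    - intros z _. apply continuity_pt_filterlim.
      apply (continuous_minus (V := R_NormedModule) U (fun z => sg * sqrt (2 * potential g z))).
      + apply (ex_derive_continuous U). eexists; apply dU.
      + apply (continuous_mult (K := R_AbsRing) (fun _ => sg)); [apply continuous_const | ].
        apply continuous_sqrt_comp.
        apply (continuous_mult (K := R_AbsRing) (fun _ => 2)); [apply continuous_const | apply CG].
    - rewrite U0, potential_0, Rmult_0_r, sqrt_0 in Ez. lra. }
  assert (HU' : forall x, Rabs x <= d -> x <> 0 ->
    exists sg, (sg = 1 \/ sg = -1) /\ U x = sg * sqrt (2 * potential g x) /\ Rabs (g x) = sg * g x).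
  { intros x Hx Hne. pose proof (Hxg x (Hab x Hx) Hne). apply Rabs_le_between in Hx.
    destruct (Rdichotomy _ _ Hne); [exists (-1) | exists 1].
    - split; [now right | split; [apply HU; [now right | lra] | rewrite Rabs_left by nra; ring]].
    - split; [now left | split; [apply HU; [now left | lra] | rewrite Rabs_pos_eq by nra; ring]]. }
  exists d, p, U, X. split; [constructor | split; [exact Hab | ]].
  - apply Hd.
  - exact Cp.
  - exact Bp.
  - unfold p. rewrite clamp_id, ext_quotient_0 by (rewrite Rabs_R0; lra).
    replace (2 * (1 / 2)) with 1 by field. rewrite sqrt_1. field.
  - exact dU.
  - exact U0.
  - exact HUX.
  - exact HXU.
  - intros x Hx. destruct (Req_dec x 0) as [-> | Hne]; [rewrite U0, g0; ring | ].
    destruct (HU' x Hx Hne) as (sg & Hsg & -> & Hgs).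
    assert (0 < sqrt (2 * potential g x)) by (apply sqrt_lt_R0; specialize (HG x Hx Hne); lra).
    rewrite (Hp x Hx Hne), Hgs.
    replace (sg * g x / sqrt (2 * potential g x) * (sg * sqrt (2 * potential g x)))
      with (sg * sg * g x) by (field; lra).
    destruct Hsg; subst; ring.
  - intros x Hx. destruct (Req_dec x 0) as [-> | Hne]; [rewrite U0, potential_0; ring | ].
    destruct (HU' x Hx Hne) as (sg & Hsg & -> & _).
    specialize (HG x Hx Hne). rewrite Rpow_mult_distr, pow2_sqrt by lra.
    destruct Hsg; subst; ring.
Qed.

(** * The potential involution *)


Lemma locally_interval (a b x : R) : a < x < b -> locally x (fun y => a < y < b).
Proof.
  intros H. apply locally_R_iff. exists (Rmin (x - a) (b - x)). split; [apply Rmin_pos; lra | ].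
  intros y Hy. pose proof (Rmin_l (x - a) (b - x)). pose proof (Rmin_r (x - a) (b - x)).
  apply Rabs_lt_between in Hy. lra.
Qed.

Lemma analytic_involution_derive (a b : R) (A : R -> R) (x : R) :
  (forall x, a < x < b -> a < A x < b) -> (forall x, a < x < b -> A (A x) = x) ->
  (forall x, a < x < b -> analytic_at A x) -> a < x < b ->
  Derive A (A x) * Derive A x = 1.
Proof.
  intros Hr Hi Ha Hx.
  assert (D1 : is_derive A x (Derive A x)) by (apply Derive_correct, analytic_at_ex_derive, Ha, Hx).
  assert (D2 : is_derive A (A x) (Derive A (A x))) by (apply Derive_correct, analytic_at_ex_derive, Ha, Hr, Hx).
  pose proof (is_derive_comp A A x _ _ D2 D1) as D3.
  apply is_derive_unique in D3.
  rewrite (Derive_ext_loc (fun x => A (A x)) (fun x => x)), Derive_id in D3.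
  - rewrite D3. apply Rmult_comm.
  - generalize (locally_interval a b x Hx). apply filter_imp. exact Hi.
Qed.

Lemma analytic_involution_derive2 (a b : R) (A : R -> R) (x : R) :
  (forall x, a < x < b -> a < A x < b) -> (forall x, a < x < b -> A (A x) = x) ->
  (forall x, a < x < b -> analytic_at A x) -> a < x < b ->
  Derive (Derive A) (A x) * Derive A x ^ 2 + Derive A (A x) * Derive (Derive A) x = 0.
Proof.
  intros Hr Hi Ha Hx.
  assert (D : forall y, a < y < b -> is_derive A y (Derive A y) /\ is_derive (Derive A) y (Derive (Derive A) y)).
  { intros y Hy. split; apply Derive_correct, analytic_at_ex_derive.
    - now apply Ha.
    - now apply analytic_at_derive, Ha. }
  destruct (D x Hx) as [D1 D2]. destruct (D (A x) (Hr x Hx)) as [_ D3].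
  pose proof (is_derive_comp (Derive A) A x _ _ D3 D1) as D4.
  pose proof (is_derive_mult _ _ x _ _ D4 D2 Rmult_comm) as D5.
  apply is_derive_unique in D5.
  rewrite (Derive_ext_loc _ (fun x => 1)), Derive_const in D5.
  - change (0 = Derive A x * Derive (Derive A) (A x) * Derive A x +
      Derive A (A x) * Derive (Derive A) x) in D5. rewrite D5. ring.
  - generalize (locally_interval a b x Hx). apply filter_imp. intros y Hy.
    now apply (analytic_involution_derive a b).
Qed.

(** Differentiating A (A x) = x twice gives, with u = A' x and s = A'' x, the values 1/u and - s/u^3
    of A' and A'' at A x; the factors u^3 then cancel in the quotient. *)
Lemma involution_expr_invariant (a b : R) (A : R -> R) (x : R) :
  (forall x, a < x < b -> a < A x < b) -> (forall x, a < x < b -> A (A x) = x) ->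
  (forall x, a < x < b -> analytic_at A x) -> a < x < b ->
  involution_expr A (A x) = involution_expr A x.
Proof.
  intros Hr Hi Ha Hx.
  pose proof (analytic_involution_derive a b A x Hr Hi Ha Hx) as E1.
  pose proof (analytic_involution_derive2 a b A x Hr Hi Ha Hx) as E2.
  unfold involution_expr.
  change (Derive_n A 2) with (Derive (Derive A)).
  set (u := Derive A x) in *. set (v := Derive A (A x)) in *.
  set (s := Derive (Derive A) x) in *. set (t := Derive (Derive A) (A x)) in *.
  assert (Hu : u <> 0) by (intros C; rewrite C in E1; lra).
  assert (Hv : v = / u) by (apply Rmult_eq_reg_r with u; [rewrite E1; field | ]; exact Hu).
  assert (Ht : t = - s / u ^ 3).
  { apply Rmult_eq_reg_r with (u ^ 2); [ | now apply pow_nonzero].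
    rewrite Hv in E2. transitivity (- (/ u * s)); [lra | field; exact Hu]. }
  rewrite Ht, Hv. destruct (Req_dec u 1) as [-> | Hu1].
  - (* [x / 0 = 0] on both sides; in fact [A] is decreasing and the case is void. *)
    replace (1 - / 1) with 0 by field. replace (1 - 1) with 0 by ring.
    rewrite pow_i by lia. unfold Rdiv. rewrite Rinv_0. ring.
  - field. repeat split; lra.
Qed.

(** * From the derivative criterion to an analytic discriminant *)

Section Potential.

Context (g : R -> R) (a b : R) (A : R -> R).
Context (Hg : forall x, analytic_at g x) (g0 : g 0 = 0) (dg0 : Derive g 0 = 1).
Context (Ha : a < 0) (Hb : 0 < b).
Context (Hxg : forall x, a < x < b -> x <> 0 -> 0 < x * g x).
Context (HA : is_potential_involution g a b A).

Let analytic_A0 : analytic_at A 0.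
Proof. apply (inv_analytic _ _ _ _ HA). lra. Qed.

Let Cg (x : R) : continuous g x.
Proof. now apply analytic_at_continuous. Qed.

(** At the fixed point 0 the chain rule gives A'(0)^2 = 1. The value 1 would make A x / x positive
    for small x > 0, against the opposite signs of x and A x. *)
Lemma potential_involution_derive_0 : Derive A 0 = -1.
Proof.
  pose proof (analytic_involution_derive a b A 0 (inv_range _ _ _ _ HA) (inv_invol _ _ _ _ HA)
    (inv_analytic _ _ _ _ HA) (conj Ha Hb)) as E.
  rewrite (inv_zero _ _ _ _ HA) in E.
  assert (Hor : Derive A 0 = -1 \/ Derive A 0 = 1).
  { assert (K : (Derive A 0 + 1) * (Derive A 0 - 1) = 0) by (ring_simplify; lra).
    apply Rmult_integral in K. lra. }
  destruct Hor as [H | H]; [exact H | exfalso].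
  assert (D : is_derive A 0 1) by (rewrite <- H; now apply Derive_correct, analytic_at_ex_derive).
  apply is_derive_Reals in D. destruct (D (1 / 2)) as [del Hdel]; [lra | ].
  set (x := Rmin (del / 2) (b / 2)). pose proof (cond_pos del) as Hdp.
  assert (Hx : 0 < x /\ x < del /\ x < b).
  { unfold x. pose proof (Rmin_l (del / 2) (b / 2)). pose proof (Rmin_r (del / 2) (b / 2)).
    split; [apply Rmin_pos; lra | lra]. }
  specialize (Hdel x ltac:(lra)). rewrite Rabs_pos_eq in Hdel by lra.
  specialize (Hdel ltac:(lra)). rewrite Rplus_0_l, (inv_zero _ _ _ _ HA), Rminus_0_r in Hdel.
  apply Rabs_lt_between in Hdel.
  pose proof (inv_sign _ _ _ _ HA x ltac:(lra) ltac:(lra)) as S.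
  assert (0 < A x / x * x ^ 2) by (apply Rmult_lt_0_compat; [lra | apply pow_lt; lra]).
  replace (A x / x * x ^ 2) with (A x * x) in H0 by (field; lra). lra.
Qed.

(** Keeps the denominators 1 - A' above 1 near 0. *)
Lemma potential_involution_locally_decreasing : locally 0 (fun x => Derive A x < 0).
Proof.
  assert (C : continuous (Derive A) 0) by now apply analytic_at_continuous, analytic_at_derive.
  apply (C (fun y => y < 0)). rewrite potential_involution_derive_0.
  apply locally_R_iff. exists 1. split; [lra | ]. intros y Hy. apply Rabs_lt_between in Hy. lra.
Qed.

(** The equation G/g^2 = 2/(1 - A')^2 cleared of denominators: a polynomial in G, g and A', hence
    analytic at 0 without any division. *)
Definition discriminant (x : R) : R :=
  2 * potential g x * (1 - Derive A x) ^ 2 - 4 * g x ^ 2.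

Lemma discriminant_analytic : analytic_at discriminant 0.
Proof.
  assert (HG := analytic_at_potential g (Hg 0)).
  assert (HA' : analytic_at (Derive A) 0) by now apply analytic_at_derive.
  assert (HGA := analytic_at_mult _ _ _ HG HA').
  assert (Hq := analytic_at_plus _ _ _ (analytic_at_scal 2 _ _ HG)
    (analytic_at_plus _ _ _ (analytic_at_scal (-4) _ _ HGA)
      (analytic_at_plus _ _ _ (analytic_at_scal 2 _ _ (analytic_at_mult _ _ _ HGA HA'))
        (analytic_at_scal (-4) _ _ (analytic_at_mult _ _ _ (Hg 0) (Hg 0)))))).
  revert Hq. apply analytic_at_ext.
  apply filter_forall. intros x. unfold discriminant. ring.
Qed.

Let limit_quotient (x : R) : R := 2 / (1 - Derive A x) ^ 2.

Lemma discriminant_0_iff (x : R) :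
  a < x < b -> Derive A x < 0 -> discriminant x = 0 <-> ext_quotient g x = limit_quotient x.
Proof.
  intros Hx HAx. unfold discriminant, limit_quotient.
  destruct (Req_dec x 0) as [-> | Hne].
  - rewrite ext_quotient_0, potential_0, g0, potential_involution_derive_0. split; intros; field.
  - rewrite ext_quotient_neq by exact Hne.
    assert (Hgx : g x <> 0) by (intros C; specialize (Hxg x Hx Hne); rewrite C in Hxg; lra).
    assert (Hd : 1 - Derive A x <> 0) by lra.
    split; intros E.
    + apply Rmult_eq_reg_r with (2 * (1 - Derive A x) ^ 2 * g x ^ 2).
      * transitivity (2 * potential g x * (1 - Derive A x) ^ 2); [field; exact Hgx | ].
        transitivity (4 * g x ^ 2); [lra | field; exact Hd].
      * repeat apply Rmult_integral_contrapositive_currified; try apply pow_nonzero; lra.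
    + replace (potential g x) with (potential g x / g x ^ 2 * g x ^ 2) by (field; exact Hgx).
      rewrite E. field. exact Hd.
Qed.

Lemma is_derive_limit_quotient (x : R) :
  a < x < b -> Derive A x < 0 -> is_derive limit_quotient x (involution_expr A x).
Proof.
  intros Hx HAx. unfold limit_quotient, involution_expr.
  change (Derive_n A 2) with (Derive (Derive A)).
  auto_derive.
  - split; [ | split; [ | exact I]].
    + now apply analytic_at_ex_derive, analytic_at_derive, (inv_analytic _ _ _ _ HA).
    + repeat apply Rmult_integral_contrapositive_currified; lra.
  - change (fun x0 : R => Derive A x0) with (Derive A). field. lra.
Qed.

(** An equality on a neighbourhood can be differentiated. Conversely, [ext_quotient g] and
    [limit_quotient] both equal 1/2 at 0, so equal derivatives make them agree. *)
Lemma discriminant_0_iff_derive :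
  locally 0 (fun x => discriminant x = 0) <->
  locally 0 (fun x => Derive (ext_quotient g) x = involution_expr A x).
Proof.
  pose proof (filter_and _ _ (locally_interval a b 0 (conj Ha Hb)) potential_involution_locally_decreasing) as L.
  split; intros H.
  - generalize (filter_and _ _ L (locally_locally _ _ (filter_and _ _ L H))).
    apply filter_imp. intros x [[H1 H2] H3].
    rewrite <- (is_derive_unique _ _ _ (is_derive_limit_quotient x H1 H2)).
    apply Derive_ext_loc. revert H3. apply filter_imp.
    intros y [[H3 H4] H5]. now apply discriminant_0_iff.
  - pose proof (filter_and _ _ L H) as K. apply locally_R_iff in K.
    destruct K as (e & He & K). apply locally_R_iff. exists e. split; [exact He | ].
    intros x Hx. destruct (K x Hx) as [[H1 H2] _]. apply discriminant_0_iff; try assumption.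
    assert (Kz : forall z, Rmin 0 x <= z <= Rmax 0 x ->
      a < z < b /\ Derive A z < 0 /\ Derive (ext_quotient g) z = involution_expr A z).
    { intros z Hz. destruct (K z) as [[K1 K2] K3]; [ | now repeat split].
      rewrite Rminus_0_r in *. apply Rle_lt_trans with (2 := Hx).
      unfold Rmin, Rmax in Hz. destruct (Rle_dec 0 x); unfold Rabs; repeat destruct Rcase_abs; lra. }
    assert (Dq : forall z, a < z < b -> z <> 0 -> ex_derive (ext_quotient g) z).
    { intros z Hz Hne.
      apply (ex_derive_ext_loc (fun x => potential g x / g x ^ 2)).
      - apply locally_R_iff. exists (Rabs z). split; [now apply Rabs_pos_lt | ]. intros y Hy.
        symmetry. apply ext_quotient_neq. intros ->. rewrite Rminus_0_l, Rabs_Ropp in Hy. lra.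
      - assert (g z <> 0) by (intros C; specialize (Hxg z Hz Hne); rewrite C in Hxg; lra).
        auto_derive. repeat split.
        + eexists. now apply is_derive_potential.
        + now apply analytic_at_ex_derive.
        + now repeat apply Rmult_integral_contrapositive_currified. }
    (* Derivatives are taken strictly between 0 and [x], so at 0 the continuity of [ext_quotient g]
       suffices. *)
    destruct (MVT_gen (fun z => ext_quotient g z - limit_quotient z) 0 x (fun _ => 0)) as (z & _ & E).
    + intros z Hz. destruct (Kz z) as (K1 & K2 & K3); [lra | ].
      replace 0 with (involution_expr A z - involution_expr A z) by ring.
      apply (is_derive_minus (V := R_NormedModule)); [ | now apply is_derive_limit_quotient].
      rewrite <- K3. apply Derive_correct. apply Dq; [exact K1 | ].
      intros ->. revert Hz. unfold Rmin, Rmax. destruct Rle_dec; lra.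
    + intros z Hz. destruct (Kz z Hz) as (K1 & K2 & _). apply continuity_pt_filterlim.
      apply (continuous_minus (V := R_NormedModule) (ext_quotient g) limit_quotient).
      * destruct (Req_dec z 0) as [-> | Hne]; [now apply ext_quotient_continuous_0 | ].
        apply (ex_derive_continuous (ext_quotient g)). now apply Dq.
      * apply (ex_derive_continuous limit_quotient). eexists. now apply is_derive_limit_quotient.
    + assert (E0 : ext_quotient g 0 = limit_quotient 0).
      { unfold limit_quotient. rewrite ext_quotient_0, potential_involution_derive_0. field. }
      cbv beta in E. lra.
Qed.

(** * The discriminant in the energy coordinate *)

Section Coordinate.

Context (d : R) (p U X : R -> R) (E : energy_coordinate g d p U X).
Context (Hab : forall x, Rabs x <= d -> a < x < b).
Context (HU : forall x, Rabs x <= d -> U x ^ 2 = 2 * potential g x).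

Let h (u : R) : R := / p (X u).

(** Equal potentials give U (A x) = U x or U (A x) = - U x. For x <> 0 the first would give A x = x,
    against the sign condition; so [A] becomes u -> - u in the energy coordinate. *)
Lemma energy_coordinate_involution :
  exists e, 0 < e /\ forall u, Rabs u < e ->
    Rabs (X u) <= d /\ Derive A (X u) < 0 /\ A (X u) = X (- u).
Proof.
  pose proof (ec_pos _ _ _ _ _ E) as Hd.
  assert (CA : continuous A 0) by now apply analytic_at_continuous.
  assert (L : locally 0 (fun x => Rabs (A x) < d)).
  { apply (CA (fun y => Rabs y < d)). apply locally_R_iff. exists d. split; [exact Hd | ].
    intros y. now rewrite (inv_zero _ _ _ _ HA), Rminus_0_r. }
  pose proof (filter_and _ _ L potential_involution_locally_decreasing) as K.
  apply locally_R_iff in K. destruct K as (e & He & K).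
  (* The halves compensate for |X u| <= 2 |u|. *)
  exists (Rmin (d / 2) (e / 2)). split; [apply Rmin_pos; lra | ].
  intros u Hu. pose proof (Rmin_l (d / 2) (e / 2)). pose proof (Rmin_r (d / 2) (e / 2)).
  pose proof (energy_coordinate_X_le g d p U X E u) as HX.
  destruct (K (X u)) as [K1 K2]; [rewrite Rminus_0_r; lra | ].
  assert (Hxd : Rabs (X u) <= d) by lra.
  split; [exact Hxd | split; [exact K2 | ]].
  set (x := X u) in *. specialize (Hab x Hxd).
  rewrite <- (ec_XU _ _ _ _ _ E (A x)). f_equal.
  rewrite <- (ec_UX _ _ _ _ _ E u). fold x.
  assert (Hsq : U (A x) ^ 2 = U x ^ 2).
  { rewrite HU, HU by lra. now rewrite (inv_potential _ _ _ _ HA). }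
  assert (Hf : (U (A x) + U x) * (U (A x) - U x) = 0) by (ring_simplify; lra).
  apply Rmult_integral in Hf. destruct Hf as [Hf | Hf]; [lra | ].
  destruct (Req_dec x 0) as [Hx0 | Hx0].
  - rewrite Hx0, (inv_zero _ _ _ _ HA), (ec_U0 _ _ _ _ _ E). ring.
  - exfalso. assert (Hfix : A x = x).
    { rewrite <- (ec_XU _ _ _ _ _ E (A x)). replace (U (A x)) with (U x) by lra.
      apply (ec_XU _ _ _ _ _ E). }
    pose proof (inv_sign _ _ _ _ HA x Hab Hx0) as S. rewrite Hfix in S. pose proof (pow2_ge_0 x). lra.
Qed.

(** Differentiating A (X u) = X (- u) expresses [h (- u)] through [h u] and A'. The excess thus
    inherits its sign from an analytic function. *)
Lemma discriminant_even_excess :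
  exists e, 0 < e /\ forall u, u <> 0 -> Rabs u < e ->
    exists k, 0 < k /\ discriminant (X u) = k * even_excess h u.
Proof.
  destruct energy_coordinate_involution as (e & He & K). exists e. split; [exact He | ].
  intros u Hu0 Hu. destruct (K u Hu) as (K1 & K2 & _).
  pose proof (energy_coordinate_X_derive g d p U X E) as DX.
  assert (Hrefl : h (- u) = - (Derive A (X u) * h u)).
  { assert (D1 : is_derive (fun u => A (X u)) u (h u * Derive A (X u))).
    { apply (is_derive_comp A X u); [ | apply DX].
      now apply Derive_correct, analytic_at_ex_derive, (inv_analytic _ _ _ _ HA), Hab. }
    assert (D2 : is_derive (fun u => X (- u)) u (-1 * h (- u))).
    { apply (is_derive_comp X (fun u => - u) u (h (- u)) (-1)); [apply DX | ].
      auto_derive; [exact I | ring]. }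
    apply is_derive_unique in D1. apply is_derive_unique in D2.
    cut (h u * Derive A (X u) = -1 * h (- u)); [lra | ].
    etransitivity; [symmetry; exact D1 | ]. etransitivity; [ | exact D2].
    apply Derive_ext_loc. apply locally_R_iff. exists (e - Rabs u). split; [lra | ]. intros v Hv. apply K.
    pose proof (Rabs_triang (v - u) u). replace (v - u + u) with v in H by ring. lra. }
  set (x := X u) in *.
  pose proof (ec_bounds _ _ _ _ _ E x) as Bp.
  (* As g = p u and 2 G = u^2, the discriminant is u^2 ((1 - A')^2 - 4 p^2), while the excess is (1
     - A' - 2 p)/(2 p). The remaining factor 1 - A' + 2 p is positive since A' < 0. *)
  exists (2 * p x * u ^ 2 * (1 - Derive A x + 2 * p x)). split.
  - apply Rmult_lt_0_compat; [apply Rmult_lt_0_compat | ]; [lra | now apply pow2_gt_0 | lra].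
  - unfold discriminant, even_excess. rewrite Hrefl.
    rewrite <- (ec_force _ _ _ _ _ E x K1), <- (HU x K1).
    unfold x at 1 4. rewrite (ec_UX _ _ _ _ _ E u). fold x.
    unfold h. fold x. field. lra.
Qed.

Lemma isochronous_iff_discriminant_0 :
  is_isochronous_center g <-> locally 0 (fun x => discriminant x = 0).
Proof.
  pose proof (ec_pos _ _ _ _ _ E) as Hd.
  assert (Ch : forall u, continuous h u) by apply (energy_coordinate_h_continuous g d p U X E).
  assert (h0 : h 0 = 1).
  { unfold h. rewrite (energy_coordinate_X0 g d p U X E), (ec_p0 _ _ _ _ _ E). field. }
  destruct discriminant_even_excess as (e & He & K).
  (* Small positive [u] correspond to small positive x, so one-sided statements pass from x to
     [u]. *)
  assert (HX : forall u, 0 < u -> 0 < X u <= 2 * u).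
  { intros u Hu. pose proof (energy_coordinate_X_le g d p U X E u) as HXu.
    pose proof (derive_ge_incr X h (1 / 2) 0 u (energy_coordinate_X_derive g d p U X E)
      (fun z => proj1 (energy_coordinate_h_bounds g d p U X E z)) ltac:(lra)) as HXl.
    rewrite (energy_coordinate_X0 g d p U X E) in HXl.
    rewrite (Rabs_pos_eq u), Rabs_pos_eq in HXu by lra. lra. }
  assert (Kp : forall u, 0 < u < e -> exists k, 0 < k /\ discriminant (X u) = k * even_excess h u).
  { intros u Hu. apply K; [lra | rewrite Rabs_pos_eq; lra]. }
  rewrite (isochronous_iff_period_constant g d p U X E).
  2: { intros x. now apply analytic_at_ex_derive. }
  2: { intros x. now apply analytic_at_continuous, analytic_at_derive. }
  2: exact g0.
  fold h.
  rewrite (period_constant_iff h Ch h0).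
  - split.
    + intros (e' & He' & Hz).
      assert (Hz' : forall u, u <> 0 -> Rabs u < e' -> even_excess h u = 0).
      { intros u Hu0 Hu. unfold Rabs in Hu. destruct Rcase_abs.
        - rewrite <- even_excess_opp. apply Hz. lra.
        - apply Hz. lra. }
      apply locally_R_iff. exists (Rmin e e' / 2). pose proof (Rmin_pos e e' He He').
      pose proof (Rmin_l e e'). pose proof (Rmin_r e e'). split; [lra | ].
      intros x Hx. rewrite Rminus_0_r in Hx.
      pose proof (energy_coordinate_U_le g d p U X E x).
      destruct (Req_dec x 0) as [-> | Hne].
      * unfold discriminant. rewrite potential_0, g0. ring.
      * assert (U x <> 0).
        { intros C. apply Hne. rewrite <- (ec_XU _ _ _ _ _ E x), C.
          apply (energy_coordinate_X0 g d p U X E). }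
        destruct (K (U x)) as (k & _ & Ek); [assumption | lra | ].
        rewrite (ec_XU _ _ _ _ _ E), Hz' in Ek by (assumption || lra). lra.
    + intros L. apply locally_R_iff in L. destruct L as (e' & He' & L).
      exists (Rmin e (e' / 2)). split; [apply Rmin_pos; lra | ].
      intros u [Hu Hu']. pose proof (Rmin_l e (e' / 2)). pose proof (Rmin_r e (e' / 2)).
      destruct (Kp u) as (k & Hk & Ek); [lra | ].
      pose proof (HX u Hu). rewrite L in Ek by (rewrite Rminus_0_r, Rabs_pos_eq; lra).
      symmetry in Ek. apply Rmult_integral in Ek. lra.
  (* The alternative required by [period_constant_iff] is carried from the analytic discriminant to
     the excess by the positive factor [k]. *)
  - destruct (analytic_at_trichotomy _ discriminant_analytic) as [L | (e' & He' & L)].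
    + apply locally_R_iff in L. destruct L as (e' & He' & L).
      exists (Rmin e (e' / 2)). split; [apply Rmin_pos; lra | left].
      intros u [Hu Hu']. pose proof (Rmin_l e (e' / 2)). pose proof (Rmin_r e (e' / 2)).
      destruct (Kp u) as (k & Hk & Ek); [lra | ].
      pose proof (HX u Hu). rewrite L in Ek by (rewrite Rminus_0_r, Rabs_pos_eq; lra).
      symmetry in Ek. apply Rmult_integral in Ek. lra.
    + exists (Rmin e (e' / 2)). split; [apply Rmin_pos; lra | right].
      destruct L as [L | L]; [left | right]; intros u [Hu Hu'];
        pose proof (Rmin_l e (e' / 2)); pose proof (Rmin_r e (e' / 2));
        (destruct (Kp u) as (k & Hk & Ek); [lra | ]);
        pose proof (HX u Hu); specialize (L (X u) ltac:(lra)); rewrite Ek in L; nra.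
Qed.

End Coordinate.

End Potential.

Theorem mainTheorem11 (g : R -> R) (a b c : R) (A : R -> R)
  (g_analytic : forall x : R, analytic_at g x)
  (g_0 : g 0 = 0)
  (dg_0 : Derive g 0 = 1)
  (a_lt_0 : a < 0) (b_gt_0 : 0 < b) (c_gt_0 : 0 < c)
  (G_a : potential g a = c) (G_b : potential g b = c)
  (G_lt_c : forall x : R, a < x < b -> x <> 0 -> potential g x < c)
  (xg_gt_0 : forall x : R, a < x < b -> x <> 0 -> 0 < x * g x)
  (A_inv : is_potential_involution g a b A) :
  (is_isochronous_center g <->
   locally 0 (fun x : R => Derive (ext_quotient g) x = involution_expr A x)) /\
  (forall x : R, a < x < b -> involution_expr A (A x) = involution_expr A x).
Proof.
  split.
  - rewrite <- (discriminant_0_iff_derive g a b A) by assumption.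
    destruct (energy_coordinate_exists g a b) as (d & p & U & X & E & Hab & HU); try assumption.
    now apply (isochronous_iff_discriminant_0 g a b A) with d p U X.
  - intros x Hx. apply (involution_expr_invariant a b); try assumption.
    + apply (inv_range _ _ _ _ A_inv).
    + apply (inv_invol _ _ _ _ A_inv).
    + apply (inv_analytic _ _ _ _ A_inv).
Qed.
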